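(* Let $(X,P,\mu)$ be a Branching Markov Chain whose underlying Markov chain $(X,P)$ is irreducible and infinite, with mean offspring numbers $m(x)=\sum_{k\ge 1}k\mu_k(x)<\infty$, $x\in X$, and suppose that $m(y)>1$ for some $y\in X$. Then $(X,P,\mu)$ is transient if and only if the following conditions, which are equivalent to each other, hold: (i) $\mathbb{E}_x\nu(x)\le 1$ for some $x\in X$ (equivalently, for all $x\in X$); (ii) $\mathbb{E}_x\nu(x_0)<\infty$ for all $x,x_0\in X$; (iii) there exists a strictly positive function $f:X\to(0,\infty)$ such that $$Pf(x)\le \frac{f(x)}{m(x)}\quad\text{for all } x\in X.$$ (That is, transience, (i) for some $x$, (i) for all $x$, (ii) and (iii) are all equivalent.)
   Context: Let $(X,P)$ be an irreducible discrete-time Markov chain on a countably infinite state space $X$ with transition probabilities $p(x,y)$, and write $Pf(x)=\sum_{y}p(x,y)f(y)$. Branching Markov Chain (BMC) $(X,P,\mu)$: for each $x\in X$ let $\mu(x)=(\mu_k(x))_{k\ge1}$ be non-negative numbers with $\sum_{k\ge1}\mu_k(x)=1$ and $m(x):=\sum_{k\ge1}k\mu_k(x)<\infty$ (so every particle has at least one offspring). At time $0$ there is one particle at a starting position $x_s\in X$. At each time step, every particle, located at $x$ say, is replaced by $k$ offspring particles at $x$ with probability $\mu_k(x)$, and then each offspring particle makes one step according to $P$; all particles branch and move independently of each other and of the past. Let $\eta(n)$ be the total number of particles at time $n$ and $x_i(n)$ the position of the $i$th particle at time $n$. $\mathbb{P}_x,\mathbb{E}_x$ denote probability and expectation for the process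 started with $x_s=x$. Let $\alpha(x):=\mathbb{P}_x\big(\sum_{n=1}^\infty\sum_{i=1}^{\eta(n)}\mathbf{1}\{x_i(n)=x\}=\infty\big)$. The BMC is recurrent if $\alpha(x)>0$ for some $x\in X$, and transient otherwise, i.e. if $\alpha(x)=0$ for all $x\in X$. BMC* with origin $x_0$ (for fixed $x_0\in X$): the process which in the first time step (from time $0$ to time $1$) behaves exactly like the BMC, and from then on behaves like the BMC except that $x_0$ is freezing: any particle located at $x_0$ at a time $n\ge1$ stays there forever and no longer splits (i.e. from the second time step on, $p(x_0,x_0)=1$ and $\mu_1(x_0)=1$). Let $\eta(n,x_0)$ be the number of particles at $x_0$ at time $n$ in the BMC* with origin $x_0$, and $\nu(x_0):=\lim_{n\to\infty}\eta(n,x_0)\in\{0,1,\ldots\}\cup\{\infty\}$. $\mathbb{E}_x\nu(x_0)$ is the expectation of $\nu(x_0)$ for the BMC* with origin $x_0$ started with one particle at $x$ (with $x=x_0$ allowed). *)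

(* Defs.v *)
From HB Require Import structures.
From mathcomp Require Import all_boot all_order all_algebra.
From mathcomp Require Import all_classical all_reals all_analysis.
Set Implicit Arguments.
Unset Strict Implicit.
Unset Printing Implicit Defensive.
Import Order.TTheory GRing.Theory Num.Theory.
Import numFieldNormedType.Exports.
Local Open Scope classical_set_scope.
Local Open Scope ring_scope.

Section underlying_chain.
Context {R : realType} {X : countType}.
Implicit Types (p : X -> X -> R) (f : X -> R).

Definition transition_matrix p : Prop :=
  (forall x y, 0 <= p x y) /\
  (forall x, (\esum_(y in [set: X]) (p x y)%:E = 1)%E).

Fixpoint nstep p (n : nat) (x y : X) : \bar R :=
  if n is n'.+1 then (\esum_(z in [set: X]) ((p x z)%:E * nstep p n' z y))%E
  else ((x == y)%:R)%:E.

Definition irreducible_chain p : Prop :=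
  forall x y, exists n, (0 < nstep p n x y)%E.

(* An unordered sum, which agrees with the usual one only for f >= 0. *)
Definition markov_op p f (x : X) : \bar R :=
  (\esum_(y in [set: X]) (p x y * f y)%:E)%E.

End underlying_chain.

Section branching_chain.
Context {R : realType} {X : countType}.
Implicit Types (p : X -> X -> R) (mu : X -> nat -> R).

(* mu x k is the probability of k offspring at x; every particle has at least
   one offspring, so the sequence indexed by k >= 1 is extended by 0 at k = 0. *)
Definition offspring_laws mu : Prop :=
  [/\ forall x k, 0 <= mu x k,
      forall x, mu x 0%N = 0 &
      forall x, (\sum_(1 <= k <oo) (mu x k)%:E = 1)%E].

Definition mean_offspring mu (x : X) : \bar R :=
  (\sum_(1 <= k <oo) (k%:R * mu x k)%:E)%E.

(* A configuration is the sequence of the positions of the particles alive, and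
   the offspring of the particles are listed in the order of their parents. *)

(* Probability that a particle at x branches into [size t] offspring, which then
   step independently to the positions listed in t. *)
Definition litter_prob p mu (x : X) (t : seq X) : R :=
  mu x (size t) * \prod_(y <- t) p x y.

(* Particles branch and move independently of each other: the law of the next
   configuration is the law of the concatenation of independent litters, summed
   over the size i of the litter of the first particle. *)
Fixpoint config_step p mu (s t : seq X) : R :=
  if s is x :: s' then
    \sum_(i < (size t).+1)
      litter_prob p mu x (take i t) * config_step p mu s' (drop i t)
  else (t == [::])%:R.

(* Under Pr the sequence C is a Markov chain on the countable set of
   configurations, started from a single particle at x, with one-step
   transition probabilities K n from time n to time n.+1. *)
Definition config_chain (K : nat -> seq X -> seq X -> R) (x : X)
    d (Omega : measurableType d) (Pr : probability Omega R)
    (C : nat -> Omega -> seq X) : Prop :=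
  (forall n s, measurable [set w | C n w = s]) /\
  (forall n (s : nat -> seq X),
     Pr [set w | forall i, (i <= n)%N -> C i w = s i] =
     ((s 0%N == [:: x])%:R * \prod_(i < n) K i (s i) (s i.+1))%:E).

Definition is_BMC p mu (x : X) d (Omega : measurableType d)
    (Pr : probability Omega R) (C : nat -> Omega -> seq X) : Prop :=
  config_chain (fun=> config_step p mu) x Pr C.

Definition freeze_p (x0 : X) p : X -> X -> R :=
  fun x y => if x == x0 then (y == x0)%:R else p x y.

Definition freeze_mu (x0 : X) mu : X -> nat -> R :=
  fun x k => if x == x0 then (k == 1%N)%:R else mu x k.

Definition is_BMC_star p mu (x0 x : X) d (Omega : measurableType d)
    (Pr : probability Omega R) (C : nat -> Omega -> seq X) : Prop :=
  config_chain
    (fun n => if n is 0%N then config_step p mu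
              else config_step (freeze_p x0 p) (freeze_mu x0 mu))
    x Pr C.

Definition visits d (Omega : measurableType d) (C : nat -> Omega -> seq X)
    (x : X) (w : Omega) : \bar R :=
  (\sum_(1 <= n <oo) ((count_mem x (C n w))%:R)%:E)%E.

Definition alpha d (Omega : measurableType d) (Pr : X -> probability Omega R)
    (C : nat -> Omega -> seq X) (x : X) : \bar R :=
  Pr x [set w | visits C x w = +oo%E].

Definition transient d (Omega : measurableType d)
    (Pr : X -> probability Omega R) (C : nat -> Omega -> seq X) : Prop :=
  forall x, alpha Pr C x = 0%E.

(* For a BMC* the counts are almost surely nondecreasing from time 1 on. *)
Definition nu d (Omega : measurableType d) (C : nat -> Omega -> seq X)
    (x0 : X) (w : Omega) : \bar R :=
  limn (fun n => ((count_mem x0 (C n w))%:R)%:E).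

(* Pr x0 x is the law of the BMC* with origin x0 started at x. *)
Definition mean_nu d (Omega : measurableType d)
    (Pr : X -> X -> probability Omega R) (C : nat -> Omega -> seq X)
    (x0 x : X) : \bar R :=
  (\int[Pr x0 x]_w nu C x0 w)%E.

End branching_chain.

(* Main.v *)
Require Import Defs.
From HB Require Import structures.
From mathcomp Require Import all_boot all_order all_algebra.
From mathcomp Require Import all_classical all_reals all_analysis.
From mathcomp Require finmap.
From mathcomp Require Import measurable_realfun ring lra.
Set Implicit Arguments.
Unset Strict Implicit.
Unset Printing Implicit Defensive.
Import Order.TTheory GRing.Theory Num.Theory.
Import numFieldNormedType.Exports.
Local Open Scope classical_set_scope.
Local Open Scope ring_scope.

(* Let M f(x) = m(x) P f(x) be the mean operator and T h(x) the expectation of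
   the product of h over the litter of x, so that one step of the process maps
   prod h to prod (T h) and sum f to sum (M f). Let b_n be the n-th iterate of
   the mean operator with x0 frozen, applied to the indicator of x0; then
   E_x nu(x0) = sup_n M b_n(x).

   If E_x0 nu(x0) <= 1, then sup_n b_n is positive, finite and M-superharmonic.
   Conversely an M-superharmonic f bounds b_n by f / f(x0).

   If f is M-superharmonic, Jensen's inequality makes h_j = T^j (exp (- f))
   nondecreasing in j. Since m(y) > 1 somewhere, the inequality is strict
   somewhere, and irreducibility carries strictness to any given state x at some
   level j. Then E prod h_j increases at time n by at least
   delta E [prod h_j * #(particles at x)], so the sum over n of these terms is
   finite. As prod h_j >= exp (- sum f), and sum f is a nonnegative
   supermartingale, hence bounded along almost every trajectory, x is visited
   finitely often.

   If E_x0 nu(x0) > 1, then M^k 1_x0 (x0) > 1 for some k, hence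
   T^k h <= h for h = 1 - eps 1_x0 with eps small: at every time j k the state x0
   is occupied with probability at least eps, and x0 is visited infinitely often
   with positive probability. Moreover, as X is infinite, M^k 1_x0 (x0) > 1
   persists for the process killed at some x <> x0, which forces
   E_x0 nu(x) = +oo. *)

(** * Weighted sums over countable sets *)

Section weighted_sums.
Context {R : realType}.
Local Open Scope ereal_scope.

Lemma esumT_le (T : choiceType) (a : T -> \bar R) (B : \bar R) :
  (forall r : seq T, uniq r -> \sum_(t <- r) a t <= B) ->
  \esum_(t in [set: T]) a t <= B.
Proof.
move=> aB; apply: ge_ereal_sup => _ [A [finA _] <-].
by rewrite fsbig_finite//; apply: aB; exact: finmap.fset_uniq.
Qed.

Lemma le_seq_esumT (T : choiceType) (a : T -> \bar R) (r : seq T) : uniq r ->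
  \sum_(t <- r) a t <= \esum_(t in [set: T]) a t.
Proof.
move=> ur; apply: ereal_sup_ubound; exists [set` r].
  by split=> //; exact: finite_seq.
by rewrite [RHS]fsbig_seq.
Qed.

Lemma le_term_esumT (T : choiceType) (a : T -> \bar R) (t : T) :
  a t <= \esum_(t in [set: T]) a t.
Proof. by have := @le_seq_esumT _ a [:: t] isT; rewrite big_seq1. Qed.

Lemma esumTZl (T : choiceType) (c : \bar R) (a : T -> \bar R) : 0 <= c ->
  (forall t, 0 <= a t) ->
  \esum_(t in [set: T]) (c * a t) = c * \esum_(t in [set: T]) a t.
Proof.
move=> c0 a0; case: c c0 => [r| |//].
- rewrite lee_fin le_eqVlt => /predU1P[<-|r0].
    by rewrite mul0e; apply: esum1 => i _; rewrite mul0e.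
  rewrite /esum -ereal_sup_pZl// image_comp; congr ereal_sup.
  by apply: eq_imagel => A _ /=; rewrite ge0_mule_fsumr.
(* For [c = +oo], both sides are [+oo] as soon as one term is positive. *)
- move=> _; have [a0'|] := pselect (forall t, a t = 0).
    by rewrite !esum1 ?mule0// => t _; rewrite a0' mule0.
  move=> /existsNP[t /eqP at0].
  have at_gt0 : 0 < a t by rewrite lt0e at0 a0.
  rewrite [RHS]gt0_mulye; last exact: lt_le_trans (le_term_esumT _ t).
  apply/eqP; rewrite -leye_eq.
  by apply: le_trans (le_term_esumT _ t); rewrite gt0_mulye.
Qed.

Lemma esumZl (T : choiceType) (I : set T) (c : \bar R) (a : T -> \bar R) :
  0 <= c -> (forall t, 0 <= a t) ->
  \esum_(t in I) (c * a t) = c * \esum_(t in I) a t.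
Proof.
move=> c0 a0; rewrite esum_mkcond [in RHS]esum_mkcond -esumTZl//.
  by apply: eq_esum => t _; case: ifP; rewrite ?mule0.
by move=> t; case: ifP.
Qed.

(** Monotone convergence for counting measure: the unordered sum is a supremum of finite sums, and
    each finite sum passes to the limit. *)
Lemma cvg_esumT (T : choiceType) (a : nat -> T -> \bar R) (b : T -> \bar R) :
  (forall n t, 0 <= a n t) ->
  (forall t, nondecreasing_seq (a^~ t)) ->
  (forall t, a^~ t @ \oo --> b t) ->
  \esum_(t in [set: T]) a n t @[n --> \oo] --> \esum_(t in [set: T]) b t.
Proof.
move=> a0 nda ab.
have ab_le n t : a n t <= b t.
  rewrite -(cvg_unique _ (ereal_nondecreasing_cvgn (nda t)) (ab t))//.
  by apply: ereal_sup_ubound; exists n.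
set S := fun n => \esum_(t in [set: T]) a n t.
have ndS : nondecreasing_seq S.
  by move=> m n mn; apply: le_esum => t _; exact: nda.
have cS := ereal_nondecreasing_cvgn ndS.
suff <- : ereal_sup (range S) = \esum_(t in [set: T]) b t by [].
apply/eqP; rewrite eq_le; apply/andP; split.
  by apply: ge_ereal_sup => _ [n _ <-]; exact: le_esum.
apply: esumT_le => r ur.
have cr : \sum_(t <- r) a n t @[n --> \oo] --> \sum_(t <- r) b t.
  by apply: cvg_nnesum => // t _; near=> n.
rewrite -(cvg_lim _ cr)//; apply: lime_le; first by apply/cvg_ex; eexists; exact: cr.
apply: nearW => n; apply: le_trans (le_seq_esumT _ ur) _.
by apply: ereal_sup_ubound; exists n.
Unshelve. all: by end_near. Qed.

(** The integral of [F] against the discrete measure with point masses [q]. Rows of [p], litter laws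
    and laws of random configurations are all used in this form. *)
Definition wsum (T : choiceType) (q : T -> R) (F : T -> \bar R) : \bar R :=
  \esum_(t in [set: T]) ((q t)%:E * F t).

Section fixed_weights.
Variables (T : choiceType) (q : T -> R).
Hypothesis q0 : forall t, (0 <= q t)%R.
Implicit Types F G : T -> \bar R.

Lemma wsum_ge0 F : (forall t, 0 <= F t) -> 0 <= wsum q F.
Proof. by move=> F0; apply: esum_ge0 => t _; rewrite mule_ge0// lee_fin. Qed.

Lemma le_wsum F G : (forall t, F t <= G t) -> wsum q F <= wsum q G.
Proof. by move=> FG; apply: le_esum => t _; rewrite lee_wpmul2l// lee_fin. Qed.

Lemma wsumD F G : (forall t, 0 <= F t) -> (forall t, 0 <= G t) ->
  wsum q (fun t => F t + G t) = wsum q F + wsum q G.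
Proof.
move=> F0 G0; rewrite /wsum -esumD; do ?by move=> t _; rewrite mule_ge0// lee_fin.
by apply: eq_esum => t _; rewrite ge0_muleDr.
Qed.

Lemma wsumZl (c : \bar R) F : 0 <= c -> (forall t, 0 <= F t) ->
  wsum q (fun t => c * F t) = c * wsum q F.
Proof.
move=> c0 F0; rewrite /wsum -esumTZl//; last by move=> t; rewrite mule_ge0// lee_fin.
by apply: eq_esum => t _; rewrite muleCA.
Qed.

Lemma wsum_cst (c : \bar R) : wsum q (fun=> 1) = 1 -> 0 <= c ->
  wsum q (fun=> c) = c.
Proof.
move=> q1 c0; rewrite -[in RHS](mule1 c) -q1 -wsumZl//.
by congr wsum; apply/funext => t; rewrite mule1.
Qed.

Lemma wsum_ge_term F t : (q t)%:E * F t <= wsum q F.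
Proof. exact: (le_term_esumT (fun t => (q t)%:E * F t)). Qed.

Lemma cvg_wsum (F : nat -> T -> \bar R) G :
  (forall n t, 0 <= F n t) ->
  (forall t, nondecreasing_seq (F^~ t)) ->
  (forall t, F^~ t @ \oo --> G t) ->
  wsum q (F n) @[n --> \oo] --> wsum q G.
Proof.
move=> F0 ndF FG; apply: cvg_esumT.
- by move=> n t; rewrite mule_ge0// lee_fin.
- by move=> t m n mn; rewrite lee_wpmul2l ?lee_fin//; exact: ndF.
- by move=> t; apply: cvgeZl.
Qed.

End fixed_weights.

Lemma eq_wsum (T : choiceType) (q : T -> R) (F G : T -> \bar R) :
  (forall t, q t != 0%R -> F t = G t) -> wsum q F = wsum q G.
Proof.
move=> FG; apply: eq_esum => t _.
by have [->|/FG->//] := eqVneq (q t) 0%R; rewrite !mul0e.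
Qed.

(** Tonelli for two discrete measures, with the product weights on pairs. *)
Lemma wsum_wsum (T U : choiceType) (q : T -> R) (r : U -> R)
    (F : T -> U -> \bar R) :
  (forall t, 0 <= q t)%R -> (forall u, 0 <= r u)%R ->
  (forall t u, 0 <= F t u) ->
  wsum q (fun t => wsum r (F t)) =
  \esum_(k in [set: T * U]) ((q k.1 * r k.2)%:E * F k.1 k.2).
Proof.
move=> q0 r0 F0; rewrite /wsum.
have qF0 t u : 0 <= (r u)%:E * F t u by rewrite mule_ge0 ?lee_fin.
transitivity (\esum_(t in [set: T]) \esum_(u in [set: U])
    ((q t)%:E * ((r u)%:E * F t u))).
  by apply: eq_esum => t _; rewrite esumTZl ?lee_fin.
rewrite esum_esum; last by move=> t u _ _; rewrite mule_ge0 ?lee_fin.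
rewrite (_ : _ `*`` _ = setT); last by apply/seteqP; split.
by apply: eq_esum => k _; rewrite muleA -EFinM.
Qed.

Lemma wsum_delta (T : choiceType) (t0 : T) (F : T -> \bar R) : 0 <= F t0 ->
  wsum (fun t => (t == t0)%:R : R) F = F t0.
Proof.
move=> F0; rewrite /wsum (esumID [set t0]); last first.
  move=> t _; case: eqVneq => [->|_]; first by rewrite mul1e.
  by rewrite mul0e.
rewrite setTI esum_set1 /= ?eqxx ?mul1e// [X in _ + X]esum1 ?adde0//.
by move=> t [_ /eqP/negPf /= ->]; rewrite mul0e.
Qed.

End weighted_sums.

(** * Litters *)

Section litters.
Context {R : realType} {X : countType}.
Variables (p : X -> X -> R) (mu : X -> nat -> R).
Hypotheses (hp : transition_matrix p) (hmu : offspring_laws mu).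
Local Open Scope ereal_scope.
Implicit Types (f g : X -> \bar R) (F : seq X -> \bar R) (x y : X).

Lemma p_ge0 x y : (0 <= p x y)%R. Proof. by case: hp. Qed.
Lemma mu_ge0 x k : (0 <= mu x k)%R. Proof. by case: hmu. Qed.

Lemma wsum_p_cst x (c : \bar R) : 0 <= c -> wsum (p x) (fun=> c) = c.
Proof.
apply: wsum_cst; first exact: p_ge0.
by have [_ p1] := hp; rewrite -[RHS](p1 x); apply: eq_esum => y _; rewrite mule1.
Qed.

(** Translates between sums over all of [nat] and the series of [offspring_laws] and
    [mean_offspring], which start at [k = 1]. *)
Lemma wsum_nneseries (q : nat -> R) (F : nat -> \bar R) :
  (forall k, 0 <= q k)%R -> (forall k, 0 <= F k) -> (q 0%N)%:E * F 0%N = 0 ->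
  wsum q F = \sum_(1 <= k <oo) ((q k)%:E * F k).
Proof.
move=> q0 F0 z; rewrite /wsum -nneseries_esumT; last first.
  by move=> k; rewrite mule_ge0// lee_fin.
rewrite nneseries_recl ?z ?add0e//.
by move=> k; rewrite mule_ge0// lee_fin.
Qed.

Lemma wsum_mu1 x : wsum (mu x) (fun=> 1) = 1.
Proof.
have [mu0 mux0 mu1] := hmu; rewrite -[RHS](mu1 x).
rewrite wsum_nneseries//; last by rewrite mux0 mul0e.
by apply: eq_eseriesr => k _; rewrite mule1.
Qed.

Lemma mean_offspringE x : mean_offspring mu x = wsum (mu x) (fun k => (k%:R)%:E).
Proof.
have [mu0 mux0 _] := hmu.
rewrite wsum_nneseries//; last by rewrite mux0 mul0e.
by apply: eq_eseriesr => k _; rewrite -EFinM mulrC.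
Qed.

Lemma mean_offspring_ge1 x : 1 <= mean_offspring mu x.
Proof.
rewrite -(wsum_mu1 x) mean_offspringE; apply: le_esum => -[|k] _.
  by have [_ -> _] := hmu; rewrite !mul0e.
by rewrite lee_wpmul2l ?lee_fin ?mu_ge0// ler1n.
Qed.

Lemma offspring_pos x : exists2 k, (0 < k)%N & (0 < mu x k)%R.
Proof.
apply: contrapT => nk; have := wsum_mu1 x; rewrite /wsum esum1 => [/eqP|k _].
  by rewrite eqe eq_sym oner_eq0.
have [_ mux0 _] := hmu.
case: k => [|k]; first by rewrite mux0 mul0e.
have [->|muk] := eqVneq (mu x k.+1) 0%R; first by rewrite mul0e.
by exfalso; apply: nk; exists k.+1 => //; rewrite lt_neqAle eq_sym muk mu_ge0.
Qed.

Lemma step_pos x : exists y, (0 < p x y)%R.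
Proof.
apply: contrapT => ny; have := wsum_p_cst x lee01; rewrite /wsum esum1 => [/eqP|y _].
  by rewrite eqe eq_sym oner_eq0.
have [->|py] := eqVneq (p x y) 0%R; first by rewrite mul0e.
by exfalso; apply: ny; exists y; rewrite lt_neqAle eq_sym py p_ge0.
Qed.

(** The expectation of [F] over the end points of [k] independent steps from [x], integrated one
    coordinate at a time so that induction on [k] applies. *)
Fixpoint step_avg x k F : \bar R :=
  if k is k'.+1 then wsum (p x) (fun y => step_avg x k' (fun t => F (y :: t)))
  else F [::].

Lemma step_avgE x k F : (forall t, 0 <= F t) ->
  step_avg x k F =
  \esum_(t in [set t | size t = k]) ((\prod_(y <- t) p x y)%:E * F t).
Proof.
elim: k F => [|k IH] F F0 /=.
  rewrite (_ : [set t | size t = 0%N] = [set [::]]).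
    by rewrite esum_set1 big_nil mul1e.
  by apply/seteqP; split => [t /= /size0nil//|t /= ->].
have prod_ge0 t : (0 <= \prod_(y <- t) p x y)%R.
  by apply: prodr_ge0 => y _; exact: p_ge0.
transitivity (\esum_(y in [set: X]) \esum_(t in [set t | size t = k])
    ((\prod_(z <- y :: t) p x z)%:E * F (y :: t))).
  apply: eq_esum => y _; rewrite IH// -esumZl ?lee_fin ?p_ge0//.
    by apply: eq_esum => t _; rewrite big_cons muleA.
  by move=> t; rewrite mule_ge0 ?lee_fin.
rewrite esum_esum; last by move=> y t _ _; rewrite mule_ge0 ?lee_fin.
rewrite (reindex_esum ([set: X] `*`` (fun=> [set t | size t = k]))
   _ (fun k => k.1 :: k.2))//; split.
- by move=> [y t] [_ /= ->].
- by move=> [y t] [y' t'] _ _ /= [-> ->].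
- by case=> [|y t] //= [tk]; exists (y, t).
Qed.

Lemma litter_ge0 x t : (0 <= litter_prob p mu x t)%R.
Proof.
rewrite mulr_ge0 ?mu_ge0//; apply: prodr_ge0 => y _; exact: p_ge0.
Qed.

(** Conditioning on the litter size: the lists are partitioned by their length. *)
Lemma wsum_litter x F : (forall t, 0 <= F t) ->
  wsum (litter_prob p mu x) F = wsum (mu x) (fun k => step_avg x k F).
Proof.
move=> F0.
have a0 t : 0 <= (\prod_(y <- t) p x y)%:E * F t.
  by rewrite mule_ge0 ?lee_fin//; apply: prodr_ge0 => y _; exact: p_ge0.
transitivity (\esum_(k in [set: nat]) \esum_(t in [set t | size t = k])
    ((mu x k)%:E * ((\prod_(y <- t) p x y)%:E * F t))).
  rewrite esum_esum; last first.
    by move=> k t _ _; rewrite mule_ge0 ?lee_fin ?mu_ge0.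
  rewrite (reindex_esum [set: seq X] _ (fun t => (size t, t))).
    by apply: eq_esum => t _; rewrite /= muleA -EFinM.
  split => //; first by move=> t t' _ _ [].
  by move=> [k t] [_ /= <-]; exists t.
by apply: eq_esum => k _; rewrite step_avgE// esumZl ?lee_fin ?mu_ge0.
Qed.

Lemma step_avg_cst x k (c : \bar R) : 0 <= c -> step_avg x k (fun=> c) = c.
Proof.
move=> c0; elim: k => [//|k IH] /=.
by under eq_fun do rewrite IH; exact: wsum_p_cst.
Qed.

(** The constant [c] carries the contribution of the offspring already placed, which the induction
    on [k] needs. *)
Lemma step_avg_sum x k (c : \bar R) f : 0 <= c -> (forall y, 0 <= f y) ->
  step_avg x k (fun t => c + \sum_(y <- t) f y) =
  c + (k%:R)%:E * wsum (p x) f.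
Proof.
move=> + f0; elim: k c => [|k IH] c c0 /=; first by rewrite big_nil mul0e.
have Pf0 := wsum_ge0 (p_ge0 x) f0.
transitivity (wsum (p x) (fun y => (c + (k%:R)%:E * wsum (p x) f) + f y)).
  congr wsum; apply/funext => y; under eq_fun do rewrite big_cons addeA.
  by rewrite IH ?adde_ge0// addeAC.
rewrite wsumD ?wsum_p_cst ?adde_ge0 ?mule_ge0 ?lee_fin//.
- by rewrite -addeA -[X in _ + (_ + X)]mul1e -ge0_muleDl ?lee_fin// -EFinD natr1.
- exact: p_ge0.
Qed.

Lemma wsum_litter1 x : wsum (litter_prob p mu x) (fun=> 1) = 1.
Proof.
rewrite wsum_litter// -[RHS](wsum_mu1 x); congr wsum.
by apply/funext => k; rewrite step_avg_cst.
Qed.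

Definition mean_op f x : \bar R := mean_offspring mu x * wsum (p x) f.

Lemma wsum_litter_sum x f : (forall y, 0 <= f y) ->
  wsum (litter_prob p mu x) (fun t => \sum_(y <- t) f y) = mean_op f x.
Proof.
move=> f0; have Pf0 := wsum_ge0 (p_ge0 x) f0.
rewrite wsum_litter; last by move=> t; apply: sume_ge0.
rewrite /mean_op mean_offspringE muleC -wsumZl//; last exact: mu_ge0.
congr wsum; apply/funext => k; rewrite muleC.
rewrite -[RHS]add0e -step_avg_sum//; congr step_avg.
by apply/funext => t; rewrite add0e.
Qed.

End litters.

(** * One step of the configuration chain *)

Section configurations.
Context {R : realType} {X : countType}.
Variables (p : X -> X -> R) (mu : X -> nat -> R).
Hypotheses (hp : transition_matrix p) (hmu : offspring_laws mu).
Local Open Scope ereal_scope.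
Implicit Types (f : X -> \bar R) (g h : X -> R) (F : seq X -> \bar R).
Implicit Types (x y : X) (s t : seq X).

Let L_ge0 := litter_ge0 hp hmu.

Lemma config_step_ge0 s t : (0 <= config_step p mu s t)%R.
Proof.
elim: s t => [|x s IH] t /=; first exact: ler0n.
by apply: sumr_ge0 => i _; rewrite mulr_ge0.
Qed.

Lemma wsum_config_nil F : (forall t, 0 <= F t) ->
  wsum (config_step p mu [::]) F = F [::].
Proof.
move=> F0; rewrite /wsum (esumID [set [::]]); last first.
  by move=> t _; rewrite mule_ge0 ?lee_fin ?config_step_ge0.
rewrite setTI esum_set1 /= ?eqxx ?mul1e// [X in _ + X]esum1 ?adde0//.
by move=> t [_ /eqP/negPf /= ->]; rewrite mul0e.
Qed.

(** The sum over cut positions in [config_step] is a convolution: a list with a cut position is the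
    same as a litter of [x] together with a configuration produced by [s], which turns the law into
    a product law. *)
Lemma wsum_config_cons x s F : (forall t, 0 <= F t) ->
  wsum (config_step p mu (x :: s)) F =
  wsum (litter_prob p mu x) (fun t =>
    wsum (config_step p mu s) (fun u => F (t ++ u))).
Proof.
move=> F0; rewrite wsum_wsum//; last exact: config_step_ge0.
have q0 t u : (0 <= litter_prob p mu x t * config_step p mu s u)%R.
  by rewrite mulr_ge0// config_step_ge0.
rewrite (reindex_esum ([set: seq X] `*`` (fun t => `I_(size t).+1)) _
  (fun k => (take k.2 k.1, drop k.2 k.1))); last first.
  split => //.
  - move=> [t i] [u j] /set_mem[_ /= it] /set_mem[_ /= ju] [tt td].
    have tu : t = u by rewrite -(cat_take_drop i t) tt td cat_take_drop.
    rewrite !ltnS in it ju; have := congr1 size tt.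
    by rewrite !size_takel// => ->; rewrite tu.
  - move=> [t u] _; exists (t ++ u, size t).
      by split => //=; rewrite size_cat ltnS leq_addr.
    by rewrite /= take_size_cat// drop_size_cat.
rewrite -(esum_esum (a := fun t i => (litter_prob p mu x (take i t) *
   config_step p mu s (drop i t))%:E * F (take i t ++ drop i t))); last first.
  by move=> t i _ _; rewrite mule_ge0 ?lee_fin.
apply: eq_esum => t _.
rewrite -[LHS]/((\sum_(i < (size t).+1) litter_prob p mu x (take i t) *
  config_step p mu s (drop i t))%R%:E * F t).
rewrite -sumEFin ge0_sume_distrl; last by move=> i _; rewrite lee_fin.
rewrite esum_fset; last 2 first.
- exact: finite_II.
- by move=> i _; rewrite mule_ge0 ?lee_fin.
rewrite -fsbig_ord.
by apply: eq_bigr => i _; rewrite cat_take_drop.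
Qed.


Lemma wsum_config1 s : wsum (config_step p mu s) (fun=> 1) = 1.
Proof.
elim: s => [|x s IH]; first by rewrite wsum_config_nil.
by rewrite wsum_config_cons// IH; exact: wsum_litter1.
Qed.

Lemma wsum_config_sum s f : (forall y, 0 <= f y) ->
  wsum (config_step p mu s) (fun t => \sum_(y <- t) f y) =
  \sum_(x <- s) mean_op p mu f x.
Proof.
move=> f0; have sf0 t : 0 <= \sum_(y <- t) f y by apply: sume_ge0.
elim: s => [|x s IH]; first by rewrite wsum_config_nil// !big_nil.
rewrite wsum_config_cons// big_cons -wsum_litter_sum// -IH.
have W0 : 0 <= wsum (config_step p mu s) (fun t => \sum_(y <- t) f y).
  exact/wsum_ge0/sf0/config_step_ge0.
rewrite -[X in _ = _ + X](wsum_cst (L_ge0 x))//; last exact: wsum_litter1.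
rewrite -wsumD//; congr wsum; apply/funext => t.
rewrite -[X in _ = X + _](wsum_cst (config_step_ge0 s))//; last exact: wsum_config1.
rewrite -wsumD//; last exact: config_step_ge0.
by congr wsum; apply/funext => u; rewrite big_cat.
Qed.

Definition unit_fun h : Prop := forall x, (0 <= h x <= 1)%R.

Lemma unit_fun_ge0 h x : unit_fun h -> (0 <= h x)%R.
Proof. by move=> /(_ x)/andP[]. Qed.

Lemma unit_fun_le1 h x : unit_fun h -> (h x <= 1)%R.
Proof. by move=> /(_ x)/andP[]. Qed.

Lemma prod_unit h t : unit_fun h -> (0 <= \prod_(y <- t) h y <= 1)%R.
Proof.
move=> uh; elim: t => [|y t /andP[IH0 IH1]]; first by rewrite big_nil ler01 lexx.
rewrite big_cons mulr_ge0 ?(unit_fun_ge0 _ uh)//=.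
by rewrite mulr_ile1 ?(unit_fun_ge0 _ uh) ?(unit_fun_le1 _ uh).
Qed.

Lemma prod_unit_ge0 h t : unit_fun h -> (0 <= \prod_(y <- t) h y)%R.
Proof. by move=> /(prod_unit t)/andP[]. Qed.

Lemma le_prod_unit g h t : unit_fun g -> (forall x, g x <= h x)%R ->
  (\prod_(y <- t) g y <= \prod_(y <- t) h y)%R.
Proof.
move=> ug gh; apply: ler_prod => y _.
by rewrite (unit_fun_ge0 _ ug) gh.
Qed.

(** The generating operator of the litter law. For [unit_fun h] the sum lies between [0] and [1], so
    [fine] loses nothing. *)
Definition gen_op h x : R :=
  fine (wsum (litter_prob p mu x) (fun t => (\prod_(y <- t) h y)%R%:E)).

Let litter_prod_bounds h x : unit_fun h ->
  0 <= wsum (litter_prob p mu x) (fun t => (\prod_(y <- t) h y)%R%:E) <= 1.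
Proof.
move=> uh; apply/andP; split.
  by apply: wsum_ge0 => // t; rewrite lee_fin prod_unit_ge0.
rewrite -(wsum_litter1 hp hmu x); apply: le_wsum => // t.
by rewrite lee_fin; have /andP[] := prod_unit t uh.
Qed.

Lemma gen_opE h x : unit_fun h ->
  wsum (litter_prob p mu x) (fun t => (\prod_(y <- t) h y)%R%:E) =
  (gen_op h x)%:E.
Proof.
move=> /(litter_prod_bounds x)/andP[W0 W1]; rewrite fineK// ge0_fin_numE//.
exact: le_lt_trans (ltry 1).
Qed.

Lemma unit_gen_op h : unit_fun h -> unit_fun (gen_op h).
Proof.
by move=> uh x; have := litter_prod_bounds x uh; rewrite gen_opE// !lee_fin.
Qed.

Lemma le_gen_op g h x : unit_fun g -> unit_fun h -> (forall x, g x <= h x)%R ->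
  (gen_op g x <= gen_op h x)%R.
Proof.
move=> ug uh gh; rewrite -lee_fin -!gen_opE//; apply: le_wsum => // t.
by rewrite lee_fin; exact: le_prod_unit.
Qed.

Lemma unit_iter_gen_op n h : unit_fun h -> unit_fun (iter n gen_op h).
Proof. by move=> uh; elim: n => [//|n IH]; exact: unit_gen_op. Qed.

Lemma le_iter_gen_op n g h : unit_fun g -> unit_fun h ->
  (forall y, g y <= h y)%R -> forall y, (iter n gen_op g y <= iter n gen_op h y)%R.
Proof.
move=> ug uh gh; elim: n => [//|n IH] y.
by apply: le_gen_op => //; exact: unit_iter_gen_op.
Qed.

Lemma prod_nseq h k y : (\prod_(z <- nseq k y) h z = h y ^+ k)%R.
Proof. by elim: k => [|k IH]; rewrite ?big_nil// big_cons IH exprS. Qed.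

Lemma litter_nseq_pos x y : (0 < p x y)%R ->
  exists2 k, (0 < k)%N & (0 < litter_prob p mu x (nseq k y))%R.
Proof.
move=> pxy; have [k k0 muk] := offspring_pos hmu x; exists k => //.
by rewrite /litter_prob size_nseq mulr_gt0// prod_nseq exprn_gt0.
Qed.

(** For some [k >= 1] the litter of [k] copies of [y] has positive probability, and on it the two
    products differ strictly; this one term separates the expectations. *)
Lemma lt_gen_op g h x y : unit_fun g -> unit_fun h ->
  (forall x, g x <= h x)%R -> (0 < p x y)%R -> (g y < h y)%R ->
  (gen_op g x < gen_op h x)%R.
Proof.
move=> ug uh gh pxy ghy; have [k k0 Lk] := litter_nseq_pos pxy.
pose D t := (\prod_(y <- t) h y - \prod_(y <- t) g y)%R.
have D0 t : (0 <= D t)%R by rewrite subr_ge0 le_prod_unit.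
rewrite -lte_fin -!gen_opE//.
have -> : (fun t => (\prod_(y <- t) h y)%R%:E) =
    fun t => (\prod_(y <- t) g y)%R%:E + (D t)%:E.
  by apply/funext => t; rewrite -EFinD addrC subrK.
rewrite wsumD//; last by move=> t; rewrite lee_fin prod_unit_ge0.
rewrite gen_opE// lteDl//.
apply: lt_le_trans (wsum_ge_term _ _ (nseq k y)).
rewrite -EFinM lte_fin mulr_gt0// subr_gt0 !prod_nseq.
by rewrite ltrXn2r ?(unit_fun_ge0 _ ug) -?lt0n.
Qed.

(** The litters of distinct particles are independent, so the expectation factorises over the
    parents. *)
Lemma wsum_config_prod s h : unit_fun h ->
  wsum (config_step p mu s) (fun t => (\prod_(y <- t) h y)%R%:E) =
  (\prod_(x <- s) gen_op h x)%R%:E.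
Proof.
move=> uh; have ph0 t : 0 <= (\prod_(y <- t) h y)%R%:E.
  by rewrite lee_fin prod_unit_ge0.
elim: s => [|x s IH]; first by rewrite wsum_config_nil// !big_nil.
rewrite wsum_config_cons// big_cons EFinM -gen_opE// -IH muleC.
rewrite -wsumZl//; last by apply: wsum_ge0 => //; exact: config_step_ge0.
congr wsum; apply/funext => t; rewrite muleC -wsumZl//; last exact: config_step_ge0.
by congr wsum; apply/funext => u; rewrite big_cat EFinM.
Qed.

End configurations.

(** * Chains of configurations *)

Section countable_random_elements.
Context {R : realType} d (Omega : measurableType d) (P : probability Omega R).
Context {T : countType} (D : Omega -> T).
Hypothesis mD : forall t, measurable [set w | D w = t].
Local Open Scope ereal_scope.

Let D_slice (A : set T) n : measurable [set w | pickle (D w) = n /\ A (D w)].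
Proof.
have [[w0 [w0n Aw0]]|ne] := pselect (exists w, pickle (D w) = n /\ A (D w)).
  rewrite (_ : [set _ | _] = [set w | D w = D w0])//.
  apply/seteqP; split => [w [wn Aw]|w /= ->//].
  by apply: (pcan_inj pickleK); rewrite wn w0n.
rewrite (_ : [set _ | _] = set0)//; apply/seteqP; split => // w [wn Aw].
by apply: ne; exists w.
Qed.

(** As [T] is countable, a preimage is a countable union of fibres, indexed here by [pickle]. *)
Lemma measurable_countable_preimage (A : set T) : measurable [set w | A (D w)].
Proof.
rewrite (_ : [set _ | _] = \bigcup_n [set w | pickle (D w) = n /\ A (D w)]).
  by apply: bigcup_measurable => n _.
apply/seteqP; split => [w Aw|w [n _ []]//].
by exists (pickle (D w)).
Qed.

Lemma measurable_fun_countable (G : T -> \bar R) :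
  measurable_fun setT (G \o D).
Proof.
by move=> _ B _; rewrite setTI; exact: (measurable_countable_preimage (G @^-1` B)).
Qed.

Definition mass (t : T) : R := fine (P [set w | D w = t]).

Lemma massE t : (mass t)%:E = P [set w | D w = t].
Proof. by rewrite fineK// fin_num_measure. Qed.

Lemma mass_ge0 t : (0 <= mass t)%R. Proof. exact/fine_ge0/measure_ge0. Qed.

Lemma integral_countable (G : T -> \bar R) : (forall t, 0 <= G t) ->
  \int[P]_w G (D w) = wsum mass G.
Proof.
move=> G0.
have mG := measurable_fun_countable G.
pose F n := [set w | pickle (D w) = n].
have mF n : measurable (F n).
  by rewrite (_ : F n = [set w | pickle (D w) = n /\ setT (D w)])//;
    apply/seteqP; split => w //= [].
have FT : \bigcup_n F n = setT.
  by apply/seteqP; split => // w _; exists (pickle (D w)).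
rewrite -[in LHS]FT ge0_integral_bigcup ?FT//; last first.
  by move=> i j _ _ [w [<- <-]].
rewrite nneseries_esumT; last by move=> n; apply: integral_ge0.
(* Integers that are not codes of elements of [T] have empty fibres and contribute nothing. *)
rewrite (esumID (range (@pickle T))); last by move=> n _; apply: integral_ge0.
rewrite [X in _ + X]esum1 ?adde0; last first.
  move=> n [_ nn]; rewrite (_ : F n = set0) ?integral_set0//.
  by apply/seteqP; split => // w wn; apply: nn; exists (D w).
rewrite setTI esum_image; last by move=> s t _ _; exact: (pcan_inj pickleK).
apply: eq_esum => t _; rewrite massE.
rewrite (_ : F (pickle t) = [set w | D w = t]); last first.
  by apply/seteqP; split => [w /(pcan_inj pickleK)//|w /= <-].
rewrite muleC -integral_cst//.
by apply: eq_integral => w /set_mem /= Dw; rewrite Dw.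
Qed.

Lemma prob_countable (A : pred T) :
  \int[P]_w ((A (D w))%:R)%:E = P [set w | A (D w)].
Proof.
rewrite -(setIT [set w | A (D w)]) -integral_indic//; last first.
  exact: (measurable_countable_preimage A).
apply: eq_integral => w _; rewrite indicE; congr (_%:R%:E); congr nat_of_bool.
by apply/idP/idP => [Aw|/set_mem//]; apply/mem_set.
Qed.

End countable_random_elements.

(** * Monotone convergence off a null set *)

Section integral_ae_limit.
Context {R : realType} d (Omega : measurableType d) (P : probability Omega R).
Local Open Scope ereal_scope.

(** The integral of a nonnegative function is a supremum over simple functions below it, so
    measurability does not enter. This matters for [nu], which is a default value wherever the
    counts do not converge. *)
Lemma ge0_le_integral_nonmeasurable (f g : Omega -> \bar R) :
  (forall w, 0 <= f w) -> (forall w, f w <= g w) ->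
  \int[P]_w f w <= \int[P]_w g w.
Proof.
move=> f0 fg; have g0 w := le_trans (f0 w) (fg w).
rewrite !ge0_integralTE//; apply: ereal_sup_le => _ [h hf <-].
by exists h => // w; exact: le_trans (hf w) (fg w).
Qed.

Lemma limn_ge0 (u : nat -> \bar R) : (forall n, 0 <= u n) -> 0 <= limn u.
Proof.
move=> u0; have [cu|ncu] := pselect (cvgn u).
  by apply: lime_ge => //; exact: nearW.
(* Without a limit, [limn] is the default point of the extended reals, which is nonnegative. *)
rewrite /lim /lim_in getPN// => l ul; apply: ncu.
by apply/cvg_ex; exists l.
Qed.

(** The limit [g] is not assumed measurable. It lies between [g'], which is [0] on [N], and [g''],
    which is [+oo] on [N]; both are measurable and agree off the null set [N], so the three
    integrals coincide. *)
Lemma integral_ae_limit (N : set Omega) (f : nat -> Omega -> \bar R)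
    (g : Omega -> \bar R) :
  measurable N -> P N = 0 ->
  (forall n, measurable_fun setT (f n)) ->
  (forall n w, 0 <= f n w) -> (forall w, 0 <= g w) ->
  (forall w, ~ N w -> nondecreasing_seq (f^~ w)) ->
  (forall w, ~ N w -> f^~ w @ \oo --> g w) ->
  \int[P]_w f n w @[n --> \oo] --> \int[P]_w g w.
Proof.
move=> mN PN mf f0 g0 ndf fg; have mNC := measurableC mN.
pose f' n := f n \_ (~` N); pose g' := g \_ (~` N).
pose g'' w := g' w + (cst +oo \_ N) w.
have mf' n : measurable_fun setT (f' n).
  by apply/(measurable_restrictT _ mNC); exact: measurable_funS (mf n).
have f'0 n w : 0 <= f' n w by rewrite /f' patchE; case: ifP.
have g'0 w : 0 <= g' w by rewrite /g' patchE; case: ifP.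
have ndf' w : nondecreasing_seq (f'^~ w).
  move=> m n mn; rewrite /f' !patchE; case: ifP => // /set_mem Nw.
  exact: ndf.
have cf' w : f'^~ w @ \oo --> g' w.
  rewrite /g' patchE; case: ifPn => [wN|wN].
    rewrite (_ : f'^~ w = f^~ w); first exact/fg/set_mem.
    by apply/funext => n; rewrite /f' patchE wN.
  rewrite (_ : f'^~ w = cst 0); first exact: cvg_cst.
  by apply/funext => n; rewrite /f' patchE (negPf wN).
have mg' : measurable_fun setT g'.
  by apply: (emeasurable_fun_cvg f') => // w _; exact: cf'.
have mg'' : measurable_fun setT g''.
  apply: emeasurable_funD => //.
  by apply/(measurable_restrictT _ mN); exact: measurable_cst.
have g''0 w : 0 <= g'' w.
  by apply: adde_ge0 => //; rewrite patchE; case: ifP => // _; exact: leey.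
have aeN (u v : Omega -> \bar R) : (forall w, ~ N w -> u w = v w) ->
    ae_eq P setT u v.
  by move=> uv; exists N; split => // w /= /not_implyP[_ uvw];
    apply: contrapT => /uv.
have <- : \int[P]_w g' w = \int[P]_w g w.
  apply/eqP; rewrite eq_le; apply/andP; split.
    apply: ge0_le_integral_nonmeasurable => // w.
    by rewrite /g' patchE; case: ifP.
  apply: (@le_trans _ _ (\int[P]_w g'' w)).
    apply: ge0_le_integral_nonmeasurable => // w; rewrite /g'' /g' !patchE.
    case: ifPn => [_|]; first by rewrite leeDl//; case: ifP => // _; exact: leey.
    by rewrite in_setC negbK => ->; rewrite add0e leey.
  rewrite (@ge0_ae_eq_integral _ _ _ P setT g'' g')//.
  apply: aeN => w Nw; rewrite /g'' [X in _ + X]patchE ifF ?adde0//.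
  by apply/negbTE; rewrite notin_setE.
have fE n : \int[P]_w f n w = \int[P]_w f' n w.
  apply: ge0_ae_eq_integral => //; apply: aeN => w Nw.
  by rewrite /f' patchE ifT// mem_set.
under eq_fun do rewrite fE.
have -> : \int[P]_w g' w = \int[P]_w limn (f'^~ w).
  by apply: eq_integral => w _; apply/esym/cvg_lim.
by apply: cvg_monotone_convergence => // w _; exact: ndf'.
Qed.

End integral_ae_limit.

(** * The Markov property of a chain of configurations *)

Section configuration_chains.
Context {R : realType} {X : countType}.
Variables (K : nat -> seq X -> seq X -> R) (x : X).
Hypothesis K0 : forall n s t, (0 <= K n s t)%R.
Context d (Omega : measurableType d) (P : probability Omega R).
Variable C : nat -> Omega -> seq X.
Hypothesis hC : config_chain K x P C.
Local Open Scope ereal_scope.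

(** The times listed are [0] to [n - 1]; thus [history n.+1] ends with the configuration at time
    [n]. *)
Definition history n w := mkseq (C^~ w) n.

Lemma measurable_history n l : measurable [set w | history n w = l].
Proof.
have [mC _] := hC.
have [ln|ln] := eqVneq (size l) n; last first.
  rewrite (_ : [set _ | _] = set0)//; apply/seteqP; split => // w /= wl.
  by move: ln; rewrite -wl size_mkseq eqxx.
rewrite (_ : [set _ | _] =
    \bigcap_i [set w | (i < n)%N -> C i w = nth [::] l i]).
  apply: bigcap_measurable => // i _.
  have [lt_in|ge_in] := ltnP i n.
    rewrite (_ : [set _ | _] = [set w | C i w = nth [::] l i])//.
    by apply/seteqP; split => w /= => [/(_ isT)|->].
  by rewrite (_ : [set _ | _] = setT)//; apply/seteqP; split.
apply/seteqP; split => [w /= <- i _ /= lt_in|w Cl].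
  by rewrite nth_mkseq.
apply: (@eq_from_nth _ [::]) => [|i]; rewrite size_mkseq ?ln// => lt_in.
by rewrite nth_mkseq// Cl.
Qed.

Lemma measurable_config n s : measurable [set w | C n w = s].
Proof. by case: hC. Qed.

Lemma mass_history_step n l s : size l = n.+1 ->
  P [set w | history n.+1 w = l /\ C n.+1 w = s] =
  P [set w | history n.+1 w = l] * (K n (last [::] l) s)%:E.
Proof.
move=> ln; have [_ hP] := hC.
pose u i := nth [::] (rcons l s) i.
have uE i : (i <= n)%N -> u i = nth [::] l i.
  by move=> i_n; rewrite /u nth_rcons ln ltnS i_n.
have usE : u n.+1 = s by rewrite /u nth_rcons ln ltnn eqxx.
have hE w : history n.+1 w = l <-> forall i, (i <= n)%N -> C i w = u i.
  split => [hl i i_n|Cu]; first by rewrite uE// -hl nth_mkseq.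
  apply: (@eq_from_nth _ [::]) => [|i]; rewrite size_mkseq ?ln// ltnS => i_n.
  by rewrite nth_mkseq// Cu// uE.
rewrite (_ : [set w | history n.+1 w = l] =
    [set w | forall i, (i <= n)%N -> C i w = u i]); last first.
  by apply/seteqP; split => w /hE.
rewrite (_ : [set w | _ /\ _] =
    [set w | forall i, (i <= n.+1)%N -> C i w = u i]); last first.
  apply/seteqP; split => [w [/hE Cu Cs] i|w Cu].
    by rewrite leq_eqVlt ltnS => /predU1P[->|/Cu//]; rewrite Cs usE.
  split; last by rewrite Cu// usE.
  by apply/hE => i i_n; apply: Cu; exact: leqW.
rewrite !hP -EFinM big_ord_recr /= mulrA usE (uE n)//.
by rewrite -[last _ _]nth_last ln.
Qed.

(** Both integrals are sums over pairs of a past and a next configuration, whose masses are matched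
    by [mass_history_step]. Keeping the whole past in [F] is what the stopping argument of the
    maximal inequality requires. *)
Lemma markov_property n (F : seq (seq X) -> seq X -> \bar R) :
  (forall l s, 0 <= F l s) ->
  \int[P]_w F (history n.+1 w) (C n.+1 w) =
  \int[P]_w wsum (K n (C n w)) (F (history n.+1 w)).
Proof.
move=> F0.
pose D w := (history n.+1 w, C n.+1 w).
have mD k : measurable [set w | D w = k].
  case: k => l s; rewrite (_ : [set _ | _] =
    [set w | history n.+1 w = l] `&` [set w | C n.+1 w = s]).
    by apply: measurableI; [exact: measurable_history|exact: measurable_config].
  by apply/seteqP; split => [w [<- <-]|w [/= <- <-]].
rewrite (integral_countable _ mD (G := fun k => F k.1 k.2))//.
have lastE w : C n w = last [::] (history n.+1 w).
  by rewrite /history mkseqS last_rcons.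
under eq_integral do rewrite lastE.
rewrite (integral_countable _ (measurable_history n.+1)
  (G := fun l => wsum (K n (last [::] l)) (F l))); last first.
  by move=> l; apply: wsum_ge0.
transitivity (\esum_(k in [set: seq (seq X) * seq X])
  (((mass P (history n.+1) k.1)%:E * (K n (last [::] k.1) k.2)%:E) * F k.1 k.2)).
  apply: eq_esum => -[l s] _ /=; congr (_ * _).
  rewrite !massE//; [|exact: measurable_history].
  (* A list of the wrong length is never a history, so both masses vanish. *)
  have [ln|ln] := eqVneq (size l) n.+1.
    rewrite -mass_history_step//; congr (P _).
    by apply/seteqP; split => [w [<- <-]|w [/= <- <-]].
  rewrite (_ : [set w | D w = _] = set0) ?measure0; last first.
    apply/seteqP; split => // w [/= wl _].
    by move: ln; rewrite -wl size_mkseq eqxx.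
  rewrite (_ : [set w | _ = l] = set0) ?measure0 ?mul0e//.
  by apply/seteqP; split => // w /= wl; move: ln; rewrite -wl size_mkseq eqxx.
rewrite -(_ : [set: seq (seq X)] `*`` (fun=> [set: seq X]) = setT); last first.
  by apply/seteqP; split.
rewrite -(esum_esum (a := fun l s => (mass P (history n.+1) l)%:E *
    (K n (last [::] l) s)%:E * F l s)); last first.
  by move=> l s _ _; rewrite !mule_ge0 ?lee_fin// mass_ge0.
apply: eq_esum => l _; rewrite -esumTZl ?lee_fin ?mass_ge0//.
  by apply: eq_esum => s _; rewrite muleA.
by move=> s; rewrite mule_ge0 ?lee_fin.
Qed.

Lemma markov_step n (G : seq X -> \bar R) : (forall s, 0 <= G s) ->
  \int[P]_w G (C n.+1 w) = \int[P]_w wsum (K n (C n w)) G.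
Proof. by move=> G0; exact: (markov_property n (F := fun=> G)). Qed.

Lemma measurable_fun_config n (G : seq X -> \bar R) :
  measurable_fun setT (G \o C n).
Proof. exact/measurable_fun_countable/measurable_config. Qed.

Lemma integral_start (G : seq X -> \bar R) : (forall s, 0 <= G s) ->
  \int[P]_w G (C 0%N w) = G [:: x].
Proof.
move=> G0; have [mC hP] := hC.
have P0 s : P [set w | C 0%N w = s] = ((s == [:: x])%:R)%:E.
  have := hP 0%N (fun=> s); rewrite big_ord0 mulr1 => <-; congr (P _).
  by apply/seteqP; split => [w /= ws i|w /(_ 0%N)/(_ isT)//]; rewrite leqn0 => /eqP ->.
rewrite (integral_countable _ (mC 0%N))// /wsum (esumID [set [:: x]]).
  rewrite setTI esum_set1 massE// P0 ?eqxx ?mul1e//.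
  rewrite [X in _ + X]esum1 ?adde0// => s [_ /= /eqP sx].
  by rewrite massE// P0 (negPf sx) mul0e.
by move=> s _; rewrite mule_ge0 ?lee_fin ?mass_ge0.
Qed.

Lemma prob_config n (A : pred (seq X)) :
  \int[P]_w ((A (C n w))%:R)%:E = P [set w | A (C n w)].
Proof. exact/prob_countable/measurable_config. Qed.

Lemma prob_step_eq0 n (A : rel (seq X)) :
  (forall s t, A s t -> K n s t = 0%R) ->
  measurable [set w | A (C n w) (C n.+1 w)] /\
  P [set w | A (C n w) (C n.+1 w)] = 0.
Proof.
move=> AK; pose D w := (C n w, C n.+1 w).
have mD k : measurable [set w | D w = k].
  case: k => s t; rewrite (_ : [set _ | _] =
    [set w | C n w = s] `&` [set w | C n.+1 w = t]).
    by apply: measurableI; exact: measurable_config.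
  by apply/seteqP; split => [w [<- <-]|w [/= <- <-]].
split; first exact: (measurable_countable_preimage mD (fun k => A k.1 k.2)).
rewrite -(prob_countable P mD (fun k => A k.1 k.2)) /=.
pose F l s := ((A (last [::] l) s)%:R)%:E : \bar R.
transitivity (\int[P]_w F (history n.+1 w) (C n.+1 w)).
  by apply: eq_integral => w _; rewrite /F /history mkseqS last_rcons.
rewrite markov_property; last by move=> l s; rewrite lee_fin ler0n.
apply: integral0_eq => w _; rewrite /wsum esum1// => s _.
rewrite /F /history mkseqS last_rcons.
by case: (boolP (A _ _)) => [/AK ->|_]; rewrite ?mul0e ?mule0.
Qed.

End configuration_chains.

(** * The mean operator *)

Section mean_operator.
Context {R : realType} {X : countType}.
Variables (p : X -> X -> R) (mu : X -> nat -> R).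
Hypotheses (hp : transition_matrix p) (hmu : offspring_laws mu).
Hypothesis hm : forall x, (mean_offspring mu x < +oo)%E.
Local Open Scope ereal_scope.
Implicit Types (f g : X -> \bar R) (x y z : X).

Local Notation M := (mean_op p mu).

Lemma mean_offspring_gt0 x : 0 < mean_offspring mu x.
Proof. exact: lt_le_trans (mean_offspring_ge1 hmu x). Qed.

Lemma mean_offspring_fin x : mean_offspring mu x \is a fin_num.
Proof. by rewrite ge0_fin_numE// ltW// mean_offspring_gt0. Qed.

Let mean_ge0 x := ltW (mean_offspring_gt0 x).

Lemma mean_op_ge0 f : (forall y, 0 <= f y) -> forall x, 0 <= M f x.
Proof. by move=> f0 x; rewrite mule_ge0// wsum_ge0// => y; exact: p_ge0. Qed.

Lemma le_mean_op f g : (forall y, f y <= g y) -> forall x, M f x <= M g x.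
Proof. by move=> fg x; rewrite lee_wpmul2l// le_wsum// => y; exact: p_ge0. Qed.

Lemma mean_opD f g : (forall y, 0 <= f y) -> (forall y, 0 <= g y) ->
  M (fun y => f y + g y) = fun x => M f x + M g x.
Proof.
move=> f0 g0; apply/funext => x; rewrite /mean_op wsumD//; last exact: p_ge0.
by rewrite ge0_muleDr// wsum_ge0// => y; exact: p_ge0.
Qed.

Lemma mean_opZl (c : \bar R) f : 0 <= c -> (forall y, 0 <= f y) ->
  M (fun y => c * f y) = fun x => c * M f x.
Proof.
move=> c0 f0; apply/funext => x; rewrite /mean_op wsumZl//; last exact: p_ge0.
by rewrite muleCA.
Qed.

Lemma mean_op_gt0 f x y : (forall y, 0 <= f y) -> (0 < p x y)%R -> 0 < f y ->
  0 < M f x.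
Proof.
move=> f0 pxy fy; rewrite mule_gt0 ?mean_offspring_gt0//.
apply: lt_le_trans (wsum_ge_term _ _ y).
by rewrite mule_gt0// lte_fin.
Qed.

Lemma cvg_mean_op (f : nat -> X -> \bar R) g :
  (forall n y, 0 <= f n y) -> (forall y, nondecreasing_seq (f^~ y)) ->
  (forall y, f^~ y @ \oo --> g y) -> forall x, M (f n) x @[n --> \oo] --> M g x.
Proof.
move=> f0 ndf fg x; apply: cvgeZl; first exact: mean_offspring_fin.
by apply: cvg_wsum => // y; exact: p_ge0.
Qed.

Lemma iter_mean_op_ge0 k f : (forall y, 0 <= f y) -> forall x, 0 <= iter k M f x.
Proof. by move=> f0; elim: k => //= k IH; exact: mean_op_ge0. Qed.

Lemma le_iter_mean_op k f g : (forall y, f y <= g y) ->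
  forall x, iter k M f x <= iter k M g x.
Proof. by move=> fg; elim: k => //= k IH; exact: le_mean_op. Qed.

Lemma iter_mean_opD k f g : (forall y, 0 <= f y) -> (forall y, 0 <= g y) ->
  iter k M (fun y => f y + g y) = fun x => iter k M f x + iter k M g x.
Proof.
move=> f0 g0; elim: k => //= k ->.
by rewrite mean_opD//; exact: iter_mean_op_ge0.
Qed.

Lemma iter_mean_opZl k (c : \bar R) f : 0 <= c -> (forall y, 0 <= f y) ->
  iter k M (fun y => c * f y) = fun x => c * iter k M f x.
Proof.
move=> c0 f0; elim: k => //= k ->.
by rewrite mean_opZl//; exact: iter_mean_op_ge0.
Qed.

Lemma iter_mean_op_sum k n (f : nat -> X -> \bar R) :
  (forall i y, 0 <= f i y) ->
  iter k M (fun y => \sum_(i < n) f i y) = fun x => \sum_(i < n) iter k M (f i) x.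
Proof.
move=> f0; elim: n => [|n IH].
  (* The zero function is written as a multiple by [0], so that homogeneity applies. *)
  rewrite (_ : (fun y => _) = fun y => 0 * 0); last first.
    by apply/funext => y; rewrite big_ord0 mul0e.
  rewrite iter_mean_opZl//; apply/funext => x.
  by rewrite big_ord0 mul0e.
under eq_fun do rewrite big_ord_recr.
rewrite iter_mean_opD ?IH//; last by move=> y; apply: sume_ge0.
by apply/funext => x; rewrite big_ord_recr.
Qed.

Definition ind x0 y : \bar R := ((y == x0)%:R)%:E.

Lemma ind_ge0 x0 y : 0 <= ind x0 y. Proof. by rewrite lee_fin ler0n. Qed.

(** The mean operator of the laws [freeze_p] and [freeze_mu] on nonnegative functions, see
    [mean_op_freeze]. *)
Definition frozen_op x0 f x : \bar R := if x == x0 then f x0 else M f x.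

(* [frozen n] is the mean number of particles sitting at [x0] at time [n] when
   [x0] is freezing from time 0 on. *)
Definition frozen x0 n : X -> \bar R := iter n (frozen_op x0) (ind x0).

Lemma frozen_ge0 x0 n y : 0 <= frozen x0 n y.
Proof.
elim: n y => [|n IH] y; first exact: ind_ge0.
rewrite -[frozen _ _ _]/(frozen_op x0 (frozen x0 n) y) /frozen_op.
by case: ifP => // _; exact: mean_op_ge0.
Qed.

Lemma frozen_origin x0 n : frozen x0 n x0 = 1.
Proof.
by elim: n => [|n IH]; rewrite /frozen /= /frozen_op /ind eqxx.
Qed.

Lemma frozenS x0 n y : y != x0 -> frozen x0 n.+1 y = M (frozen x0 n) y.
Proof. by move=> /negPf yx0; rewrite /frozen iterS {1}/frozen_op yx0. Qed.

Lemma frozen_nd x0 n y : frozen x0 n y <= frozen x0 n.+1 y.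
Proof.
elim: n y => [|n IH] y; have [->|yx0] := eqVneq y x0; rewrite ?frozen_origin//.
  by rewrite (_ : frozen x0 0 y = 0) ?frozen_ge0// /frozen /= /ind (negPf yx0).
by rewrite !frozenS//; exact: le_mean_op.
Qed.

Lemma nd_frozen x0 y : nondecreasing_seq (fun n => frozen x0 n y).
Proof. by apply/nondecreasing_seqP => n; exact: frozen_nd. Qed.

(** A particle frozen by time [n] made its first visit to [x0] at some time [i <= n], and the first
    visits are among all visits. *)
Lemma frozen_le_sum x0 n y : frozen x0 n y <= \sum_(i < n.+1) iter i M (ind x0) y.
Proof.
have it0 k z := iter_mean_op_ge0 k (ind_ge0 x0) z.
elim: n y => [|n IH] y; first by rewrite big_ord1.
rewrite big_ord_recl; have [->|yx0] := eqVneq y x0.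
  rewrite frozen_origin (_ : iter ord0 M (ind x0) x0 = 1); last first.
    by rewrite /= /ind eqxx.
  by rewrite leeDl//; apply: sume_ge0 => i _; exact: it0.
rewrite frozenS//; apply: le_trans (le_mean_op IH y) _.
rewrite (@iter_mean_op_sum 1 n.+1 (fun i => iter i M (ind x0)) it0 : M _ = _).
exact/leeDr/ind_ge0.
Qed.

(** The outer [M] is the first step, during which [x0] is not yet freezing; [integral_nu] identifies
    the value with the expectation of [nu]. *)
Definition mean_returns x0 x : \bar R :=
  ereal_sup (range (fun n => M (frozen x0 n) x)).

Lemma nd_returns x0 x : nondecreasing_seq (fun n => M (frozen x0 n) x).
Proof.
by apply/nondecreasing_seqP => n; apply: le_mean_op => y; exact: frozen_nd.
Qed.

(** The normalised function [f / f x0] is superharmonic and equals [1] at [x0], so by induction it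
    dominates every [frozen x0 n]. *)
Lemma returns_le_superharmonic x0 (f : X -> R) x : (forall y, 0 < f y)%R ->
  (forall y, M (EFin \o f) y <= (f y)%:E) ->
  mean_returns x0 x <= (f x / f x0)%:E.
Proof.
move=> f0 Mf; pose c := (f x0)^-1%:E.
have c0 : 0 <= c by rewrite lee_fin invr_ge0 ltW.
have Mfc y : M (fun y => c * (f y)%:E) y <= c * (f y)%:E.
  by rewrite mean_opZl//; [exact: lee_wpmul2l|move=> z; rewrite lee_fin ltW].
have fr n y : frozen x0 n y <= c * (f y)%:E.
  elim: n y => [|n IH] y; have [->|yx0] := eqVneq y x0.
  - by rewrite frozen_origin -EFinM mulVf// gt_eqF.
  - by rewrite /frozen /= /ind (negPf yx0) mule_ge0// lee_fin ltW.
  - by rewrite frozen_origin -EFinM mulVf// gt_eqF.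
  - by rewrite frozenS//; apply: le_trans (Mfc y); exact: le_mean_op.
apply: ge_ereal_sup => _ [n _ <-].
rewrite mulrC EFinM; apply: le_trans (Mfc x).
by apply: le_mean_op; exact: fr.
Qed.

(** By contradiction: let all [g k] be at most [1], and choose [n] and [eta] with
    [M (frozen x0 n) x0 >= 1 + eta]. Then [frozen x0 n + eta * ind x0 <= M (frozen x0 n)] pointwise,
    so [v] grows by at least [eta * g j] at step [j], while [v j] is at most a sum of [n + 1]
    consecutive values of [g], hence at most [n + 1]. As [v j >= 1], each such block has sum at
    least [1], so the growth is unbounded. *)
Lemma iter_gt1_of_returns_gt1 x0 : 1 < mean_returns x0 x0 ->
  exists k, 1 < iter k M (ind x0) x0.
Proof.
move=> /ereal_sup_gt[_ [n _ <-] gt1]; apply: contrapT => nk.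
have g_le1 k : iter k M (ind x0) x0 <= 1.
  by rewrite leNgt; apply/negP => g1; apply: nk; exists k.
pose g k := iter k M (ind x0) x0.
pose v j := iter j M (frozen x0 n) x0.
have [eta eta0 eta1] : exists2 eta : R, (0 < eta)%R &
    1 + eta%:E <= M (frozen x0 n) x0.
  move: gt1; case: (M (frozen x0 n) x0) => [r| |//].
    rewrite lte_fin => r1; exists (r - 1)%R; first by rewrite subr_gt0.
    by rewrite -EFinD addrC subrK.
  by move=> _; exists 1%R => //; rewrite leey.
have eta_ge0 : 0 <= eta%:E by rewrite lee_fin ltW.
have g0 k : 0 <= g k by apply: iter_mean_op_ge0; exact: ind_ge0.
have vS j : v j + eta%:E * g j <= v j.+1.
  rewrite /v iterSr.
  have -> : v j + eta%:E * g j =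
      iter j M (fun y => frozen x0 n y + eta%:E * ind x0 y) x0.
    rewrite iter_mean_opD ?iter_mean_opZl//.
    - exact: ind_ge0.
    - exact: frozen_ge0.
    - by move=> y; rewrite mule_ge0// ind_ge0.
  apply: le_iter_mean_op => y; have [->|yx0] := eqVneq y x0.
    by rewrite frozen_origin /ind eqxx mule1.
  by rewrite /ind (negPf yx0) mule0 adde0 -frozenS// frozen_nd.
have v_ge1 j : 1 <= v j.
  elim: j => [|j IH]; first by rewrite /v /= frozen_origin.
  apply: le_trans (vS j); apply: le_trans IH _.
  by rewrite leeDl// mule_ge0.
have v_le j : v j <= \sum_(i < n.+1) g (j + i)%N.
  have -> : \sum_(i < n.+1) g (j + i)%N =
      iter j M (fun y => \sum_(i < n.+1) iter i M (ind x0) y) x0.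
    rewrite (@iter_mean_op_sum j n.+1 (fun i => iter i M (ind x0))); last first.
      by move=> i y; apply: iter_mean_op_ge0; exact: ind_ge0.
    by apply: eq_bigr => i _; rewrite /g iterD.
  by apply: le_iter_mean_op; exact: frozen_le_sum.
have S_le J : eta%:E * \sum_(0 <= j < J) g j <= v J.
  elim: J => [|J IH].
    by rewrite big_nil mule0; apply: le_trans (v_ge1 0%N).
  rewrite big_nat_recr//= ge0_muleDr ?sume_ge0//.
  by apply: le_trans (vS J); rewrite leeD2r.
have S_ge Q : (Q%:R)%:E <= \sum_(0 <= j < n.+1 * Q) g j.
  elim: Q => [|Q IH]; first by rewrite muln0 big_nil.
  rewrite mulnS addnC (big_cat_nat (n := n.+1 * Q))//= ?leq_addr//.
  rewrite -natr1 EFinD leeD//; apply: le_trans (v_ge1 _) _.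
  apply: le_trans (v_le (n.+1 * Q)%N) _.
  set m := (n.+1 * Q)%N.
  have -> : \sum_(m <= j < m + n.+1) g j = \sum_(i < n.+1) g (i + m)%N.
    by rewrite -{1}[m]add0n big_addn addKn big_mkord.
  by apply: lee_sum => i _; rewrite addnC.
have vJ_le J : v J <= (n.+1%:R)%:E.
  apply: le_trans (v_le J) _.
  apply: (@le_trans _ _ (\sum_(i < n.+1) 1)).
    by apply: lee_sum => i _; exact: g_le1.
  by rewrite sumEFin sumr_const card_ord.
(* With [Q > (n + 1) / eta] blocks the accumulated growth exceeds the bound [n + 1]. *)
pose Q := (Num.truncn (n.+1%:R / eta)).+1.
have := le_trans (lee_wpmul2l eta_ge0 (S_ge Q)) (le_trans (S_le _) (vJ_le _)).
rewrite -EFinM lee_fin mulrC -ler_pdivlMr// leNgt => /negP; apply.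
by rewrite truncnS_gt.
Qed.

End mean_operator.

(** * Irreducibility as an induction principle *)

Section irreducible_chains.
Context {R : realType} {X : countType}.
Variables (p : X -> X -> R).
Hypotheses (hp : transition_matrix p) (irr : irreducible_chain p).
Local Open Scope ereal_scope.

Lemma nstep_ge0 n x y : 0 <= nstep p n x y.
Proof.
elim: n x => [|n IH] x /=; first by rewrite lee_fin ler0n.
by apply: esum_ge0 => z _; rewrite mule_ge0 ?lee_fin ?p_ge0.
Qed.

(** Induction along a path of positive probability from [x] to [y]: a property inherited by
    predecessors spreads from [y] to all states. *)
Lemma irreducible_ind (A : X -> Prop) (y : X) :
  (forall x z, (0 < p x z)%R -> A z -> A x) -> A y -> forall x, A x.
Proof.
move=> Astep Ay x; have [n] := irr x y; elim: n x => [|n IH] x /=.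
  by case: eqVneq => [->//|_]; rewrite ltxx.
move=> gt0; apply: contrapT => nAx; move: gt0; rewrite esum1 ?ltxx// => z _.
have [nz|] := boolP (0 < nstep p n z y); last first.
  by rewrite lt0e nstep_ge0 andbT negbK => /eqP ->; rewrite mule0.
have [->|pxz] := eqVneq (p x z) 0%R; first by rewrite mul0e.
exfalso; apply: nAx; apply: Astep (IH _ nz).
by rewrite lt_neqAle eq_sym pxz p_ge0.
Qed.

Lemma irreducible_ind_fwd (A : X -> Prop) (x : X) :
  (forall y z, (0 < p y z)%R -> A y -> A z) -> A x -> forall y, A y.
Proof.
move=> Astep Ax y; apply: contrapT => nAy.
have := @irreducible_ind (fun z => ~ A z) y; apply => // [u z puz nAz Au|].
  by apply: nAz; exact: Astep puz Au.
exact: Ax.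
Qed.

End irreducible_chains.

(** * Superharmonic functions and taboo states *)

Section irreducible_mean_operator.
Context {R : realType} {X : countType}.
Variables (p : X -> X -> R) (mu : X -> nat -> R).
Hypotheses (hp : transition_matrix p) (hmu : offspring_laws mu).
Hypothesis hm : forall x, (mean_offspring mu x < +oo)%E.
Hypothesis irr : irreducible_chain p.
Local Open Scope ereal_scope.
Implicit Types (f g : X -> \bar R) (x y z : X).

Local Notation M := (mean_op p mu).
Local Notation frozen := (frozen p mu).
Local Notation mean_returns := (mean_returns p mu).

(** An infinite value at [z] forces [M g y = +oo] for each [y] with [p y z > 0], so finiteness
    passes to successors. *)
Lemma superharmonic_fin g x0 : (forall y, 0 <= g y) ->
  (forall y, M g y <= g y) -> g x0 \is a fin_num -> forall x, g x \is a fin_num.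
Proof.
move=> g0 Mg gx0; apply: (irreducible_ind_fwd hp irr) gx0 => y z pyz.
rewrite !ge0_fin_numE// => gy; rewrite ltey; apply/negP => /eqP gz.
have := le_lt_trans (Mg y) gy; rewrite ltNge => /negP; apply.
have pos : 0 < wsum (p y) g.
  apply: lt_le_trans (wsum_ge_term _ _ z).
  by rewrite gz gt0_muley// lte_fin.
have Wy : wsum (p y) g = +oo.
  apply/eqP; rewrite -leye_eq; apply: le_trans (wsum_ge_term _ _ z).
  by rewrite gz gt0_muley// lte_fin.
by rewrite /mean_op Wy gt0_muley// mean_offspring_gt0.
Qed.

Lemma frozen_gt0 x0 x : exists n, 0 < frozen x0 n x.
Proof.
move: x; apply: (@irreducible_ind _ _ _ hp irr
  (fun x => exists n, 0 < frozen x0 n x) x0); last first.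
  by exists 0%N; rewrite frozen_origin.
move=> x z pxz [n fz]; have [->|xx0] := eqVneq x x0.
  by exists 0%N; rewrite frozen_origin.
exists n.+1; rewrite frozenS//; apply: (mean_op_gt0 _ _ pxz) => //.
by move=> y; exact: frozen_ge0.
Qed.

(** The limit [B] of [frozen x0 n] is the function sought. Off [x0], applying [M] to a term gives
    the next term; at [x0] it gives at most [mean_returns x0 x0 <= 1 = B x0]. Irreducibility makes
    [B] finite and positive everywhere. *)
Lemma superharmonic_of_returns_le1 x0 : mean_returns x0 x0 <= 1 ->
  exists f : X -> R, (forall x, 0 < f x)%R /\
    (forall x, M (EFin \o f) x <= (f x)%:E).
Proof.
move=> U1; pose B y := ereal_sup (range (fun n => frozen x0 n y)).
have leB n y : frozen x0 n y <= B y by apply: ereal_sup_ubound; exists n.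
have B0 y : 0 <= B y by apply: le_trans (leB 0%N y); exact: frozen_ge0.
have cB y : frozen x0 n y @[n --> \oo] --> B y.
  exact/ereal_nondecreasing_cvgn/nd_frozen.
have MB x : M B x <= B x.
  have cM : M (frozen x0 n) x @[n --> \oo] --> M B x.
    apply: cvg_mean_op => //; [by move=> n y; exact: frozen_ge0|].
    by move=> y; exact: nd_frozen.
  rewrite -(cvg_lim _ cM)//; apply: lime_le; first by apply/cvg_ex; exists (M B x).
  apply: nearW => n; have [->|xx0] := eqVneq x x0; last by rewrite -frozenS.
  apply: (le_trans _ (leB 0%N x0)); rewrite frozen_origin; apply: le_trans U1.
  by apply: ereal_sup_ubound; exists n.
have Bfin : forall x, B x \is a fin_num.
  apply: (@superharmonic_fin B x0) => //.
  rewrite (_ : B x0 = 1)//; apply/eqP; rewrite eq_le; apply/andP; split.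
    by apply: ge_ereal_sup => _ [n _ <-]; rewrite frozen_origin.
  by rewrite -(frozen_origin p mu x0 0).
exists (fine \o B); split => [x|x] /=.
  rewrite -lte_fin fineK//; have [n] := frozen_gt0 x0 x.
  by move=> /lt_le_trans; apply.
rewrite fineK//; rewrite (_ : EFin \o _ = B)//.
by apply/funext => y /=; rewrite fineK.
Qed.

(** The mean operator when particles are killed on arrival at [x]; a particle that starts at [x]
    still branches and moves. *)
Definition taboo_op x f := M (fun y => if y == x then 0 else f y).

Lemma le_taboo_op x f g : (forall y, f y <= g y) ->
  forall y, taboo_op x f y <= taboo_op x g y.
Proof. by move=> fg; apply: le_mean_op => // y; case: ifP. Qed.

Lemma iter_taboo_ge0 x j f : (forall y, 0 <= f y) ->
  forall y, 0 <= iter j (taboo_op x) f y.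
Proof.
move=> f0; elim: j => [//|j IH] y; rewrite iterS {1}/taboo_op.
by apply: mean_op_ge0 => // z; case: ifP.
Qed.

(** Restricting the arrivals to the first [N] states of an enumeration gives [k]-step means that
    increase to the full one, so some [N] already gives more than [1]. Infinitely many states lie
    beyond [N], and forbidding one of them removes less than the restriction does. *)
Lemma exists_taboo k x0 : infinite_set [set: X] -> 1 < iter k M (ind x0) x0 ->
  exists2 x, x != x0 & 1 < iter k (taboo_op x) (ind x0) x0.
Proof.
move=> infX gt1.
pose tr (N : nat) f y := if (pickle y < N)%N then f y else 0.
pose a k N := iter k (fun f => M (tr N f)) (ind x0) : X -> \bar R.
have aS k' N y : a k'.+1 N y = M (tr N (a k' N)) y by [].
have a0 k' N y : 0 <= a k' N y.
  elim: k' y => [|k' IH] y; first exact: ind_ge0.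
  by rewrite aS; apply: mean_op_ge0 => // z; rewrite /tr; case: ifP.
have nda k' y : nondecreasing_seq (a k' ^~ y).
  elim: k' y => [|k' IH] y m n mn //; rewrite !aS; apply: le_mean_op => // z; rewrite /tr.
  case: ltnP => [zm|_]; first by rewrite (leq_trans zm mn); exact: IH.
  by case: ifP => // _; exact: a0.
have ca k' y : a k' N y @[N --> \oo] --> iter k' M (ind x0) y.
  elim: k' y => [|k' IH] y; first exact: cvg_cst.
  apply: (@cvg_mean_op _ _ _ _ hp hmu hm (fun N => tr N (a k' N))).
  - by move=> N z; rewrite /tr; case: ifP.
  - move=> z m n mn; rewrite /tr.
    case: ltnP => [zm|_]; first by rewrite (leq_trans zm mn); exact: nda.
    by case: ifP => // _; exact: a0.
  - move=> z; apply: cvg_trans (IH z); apply: near_eq_cvg.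
    by exists (pickle z).+1 => // N /= zN; rewrite /tr zN.
have [N0 aN0] : exists N, 1 < a k N x0.
  apply: contrapT => nN; move: gt1; rewrite ltNge => /negP; apply.
  have := ca k x0 => /cvg_lim <-//; apply: lime_le.
    by apply/cvg_ex; exists (iter k M (ind x0) x0).
  apply: nearW => N; rewrite leNgt; apply/negP => aN; apply: nN.
  by exists N.
(* Raising [N] above the code of [x0] ensures that the forbidden state differs from [x0]. *)
pose N := maxn N0 (pickle x0).+1.
have aN : 1 < a k N x0.
  by apply: lt_le_trans aN0 _; apply: nda; rewrite /= leq_maxl.
have [x Nx] : exists x : X, (N <= pickle x)%N.
  apply: contrapT => nx; apply: infX.
  rewrite (_ : [set: X] = pickle @^-1` `I_N).
    apply: finite_preimage; last exact: finite_II.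
    by move=> y z _ _; exact: (pcan_inj pickleK).
  apply/seteqP; split => // y _ /=; rewrite ltnNge; apply/negP => Ny.
  by apply: nx; exists y.
exists x.
  apply: contraTneq Nx => ->; rewrite -ltnNge; exact: leq_maxr.
apply: lt_le_trans aN _.
suff aT k' y : a k' N y <= iter k' (taboo_op x) (ind x0) y by exact: aT.
elim: k' y => [//|k' IH] y; rewrite aS iterS {1}/taboo_op.
apply: le_mean_op => // z; rewrite /tr.
have [zN|_] := ltnP.
  by case: eqVneq zN => [->|_ _]; [rewrite ltnNge Nx|exact: IH].
by case: ifP => // _; apply: iter_taboo_ge0; exact: ind_ge0.
Qed.

(** In [k] steps avoiding [x], a particle at [x0] has [gam > 1] descendants at [x0] on average, each
    of which yields [u n x0] particles at [x]. So [u n x0 * gam <= U] for all [n], which a finite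
    positive [U] contradicts. *)
Lemma mean_returns_eq_pinfty x0 x k : x != x0 ->
  1 < iter k (taboo_op x) (ind x0) x0 -> mean_returns x x0 = +oo.
Proof.
move=> xx0 gt1; pose u n := M (frozen x n).
have u_le n y : taboo_op x (u n) y <= u n.+1 y.
  rewrite /taboo_op /u; apply: le_mean_op => // z.
  case: eqVneq => [_|zx]; first exact: frozen_ge0.
  by rewrite frozenS.
have u0 n y : 0 <= u n y by apply: mean_op_ge0 => // z; exact: frozen_ge0.
have iter_le j n y : iter j (taboo_op x) (u n) y <= u (j + n)%N y.
  elim: j y => [//|j IH] y; rewrite iterS addSn; apply: le_trans (u_le _ _).
  exact: le_taboo_op.
set U := mean_returns x x0.
have u_leU n : u n x0 <= U by apply: ereal_sup_ubound; exists n.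
have U0 : 0 <= U by apply: le_trans (u_leU 0%N).
set gam := iter k (taboo_op x) (ind x0) x0 in gt1.
have scale n : u n x0 * gam <= U.
  apply: le_trans (u_leU (k + n)%N); apply: le_trans (iter_le _ _ _).
  suff H j y : u n x0 * iter j (taboo_op x) (ind x0) y <=
      iter j (taboo_op x) (u n) y by exact: H.
  elim: j y => [|j IH] y /=.
    rewrite /ind; have [->|_] := eqVneq y x0; first by rewrite mule1.
    by rewrite mule0.
  rewrite {1}/taboo_op; set g := (X in M X y).
  have g0 z : 0 <= g z.
    by rewrite /g; case: ifP => // _; apply: iter_taboo_ge0; exact: ind_ge0.
  have <- : M (fun z => u n x0 * g z) y = u n x0 * M g y by rewrite mean_opZl.
  apply: le_mean_op => // z; rewrite /g; case: ifP => _; first by rewrite mule0.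
  exact: IH.
have Upos : 0 < U.
  have [n] := frozen_gt0 x x0 => fn; apply: lt_le_trans (u_leU n).
  by rewrite /u -frozenS 1?eq_sym//; apply: lt_le_trans fn _; exact: frozen_nd.
apply/eqP; rewrite -leye_eq leNgt; apply/negP => Ufin.
(* As [gam] may be infinite, a real [c > 1] below it replaces it. *)
have [c c1 cgam] : exists2 c : R, (1 < c)%R & c%:E <= gam.
  move: gt1; case: gam {scale} => [r r1| _|//]; first by exists r.
  by exists 2%R; [rewrite ltr1n|rewrite leey].
have c0 : (0 < c)%R by rewrite (lt_trans _ c1).
have Ufn : U \is a fin_num by rewrite ge0_fin_numE.
have : U <= U * c^-1%:E.
  apply: ge_ereal_sup => _ [n _ <-]; rewrite lee_pdivlMr//.
  exact: le_trans (lee_wpmul2l (u0 n x0) cgam) (scale n).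
move: Upos Ufin; rewrite -(fineK Ufn) => Upos _; rewrite -EFinM lee_fin.
by apply/negP; rewrite -ltNge ltr_pdivrMr// ltr_pMr.
Qed.

End irreducible_mean_operator.

(** * The process with a freezing origin *)

Section freezing.
Context {R : realType} {X : countType}.
Variables (p : X -> X -> R) (mu : X -> nat -> R).
Hypotheses (hp : transition_matrix p) (hmu : offspring_laws mu).
Variable x0 : X.
Local Open Scope ereal_scope.

Local Notation p' := (freeze_p x0 p).
Local Notation mu' := (freeze_mu x0 mu).

Lemma transition_matrix_freeze : transition_matrix p'.
Proof.
have [p0 p1] := hp; split => [x y|x]; rewrite /freeze_p.
  by case: ifP.
case: (x == x0) => //.
rewrite -[RHS](@wsum_delta _ _ x0 (fun=> 1) lee01)//.
by apply: eq_esum => y _; rewrite mule1.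
Qed.

Lemma offspring_laws_freeze : offspring_laws mu'.
Proof.
have [mu0 mux0 mu1] := hmu; split => [x k|x|x]; rewrite /freeze_mu.
- by case: ifP => // _; rewrite ler0n.
- by case: ifP.
- case: (x == x0) => //.
  rewrite -[RHS](@wsum_delta _ _ 1%N (fun=> 1) lee01)//.
  rewrite wsum_nneseries//; last by rewrite mul0e.
  by apply: eq_eseriesr => k _; rewrite mule1.
Qed.

Lemma mean_op_freeze (f : X -> \bar R) : (forall y, 0 <= f y) ->
  mean_op p' mu' f = frozen_op p mu x0 f.
Proof.
move=> f0; apply/funext => x; rewrite /frozen_op /mean_op.
rewrite mean_offspringE; last exact: offspring_laws_freeze.
have [->|xx0] := eqVneq x x0; last first.
  rewrite mean_offspringE//; congr (_ * _).
    by congr wsum; apply/funext => k; rewrite /freeze_mu (negPf xx0).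
  by congr wsum; apply/funext => k; rewrite /freeze_p (negPf xx0).
rewrite (_ : mu' x0 = fun k => (k == 1%N)%:R); last first.
  by apply/funext => k; rewrite /freeze_mu eqxx.
rewrite (_ : p' x0 = fun y => (y == x0)%:R); last first.
  by apply/funext => k; rewrite /freeze_p eqxx.
by rewrite !wsum_delta ?mul1e// lee_fin ler0n.
Qed.

(** The only litter of positive probability of a frozen particle is the singleton of [x0]. *)
Lemma count_freeze_nd s t : config_step p' mu' s t != 0%R ->
  (count_mem x0 s <= count_mem x0 t)%N.
Proof.
elim: s t => [//|x s IH] t /= st.
have [i Ki] : exists i : 'I_(size t).+1, (litter_prob p' mu' x (take i t) *
    config_step p' mu' s (drop i t) != 0)%R.
  apply: contrapT => ni; move/eqP: st; apply; apply: big1 => i _.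
  by apply/eqP; apply: contrapT => /negP Ki; apply: ni; exists i.
have [Li Ci] : litter_prob p' mu' x (take i t) != 0%R /\
    config_step p' mu' s (drop i t) != 0%R.
  by move: Ki; rewrite mulf_eq0 negb_or => /andP.
rewrite -(cat_take_drop i t) count_cat leq_add ?IH//.
move: Li; have [->|//] := eqVneq x x0; rewrite /litter_prob /freeze_mu /freeze_p !eqxx.
case: (take i t) => [|y [|z u]] /=; rewrite ?mul0r ?eqxx//.
by rewrite big_seq1 mul1r pnatr_eq0 addn0 lt0n.
Qed.

End freezing.

(** * The expectation of the final frozen count *)

Section frozen_process.
Context {R : realType} {X : countType}.
Variables (p : X -> X -> R) (mu : X -> nat -> R).
Hypotheses (hp : transition_matrix p) (hmu : offspring_laws mu).
Variables (x0 x : X).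
Context d (Omega : measurableType d) (P : probability Omega R).
Variable C : nat -> Omega -> seq X.
Hypothesis hC : is_BMC_star p mu x0 x P C.
Local Open Scope ereal_scope.

Lemma count_memE (z : X) s :
  ((count_mem z s)%:R)%:E = \sum_(y <- s) ind z y :> \bar R.
Proof.
elim: s => [|y s IH]; rewrite ?big_nil// big_cons -IH /= natrD EFinD.
by rewrite /ind eq_sym.
Qed.

Let p'_tm := transition_matrix_freeze hp x0.
Let mu'_ol := offspring_laws_freeze hmu x0.

Let K n := if n is 0%N then config_step p mu
           else config_step (freeze_p x0 p) (freeze_mu x0 mu).

Let K_ge0 n s t : (0 <= K n s t)%R.
Proof. by case: n => [|n]; exact: config_step_ge0. Qed.

Lemma integral_sum_star n (f : X -> \bar R) : (forall y, 0 <= f y) ->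
  \int[P]_w (\sum_(y <- C n.+1 w) f y) =
  mean_op p mu (iter n (frozen_op p mu x0) f) x.
Proof.
move=> f0.
have sum0 g s : (forall y, 0 <= g y) -> 0 <= \sum_(y <- s) g y :> \bar R.
  by move=> g0; apply: sume_ge0.
elim: n f f0 => [|n IH] f f0.
  rewrite (markov_step (K := K) K_ge0 hC _ (G := fun s => \sum_(y <- s) f y))//;
    last by move=> s; exact: sum0.
  under eq_integral do rewrite wsum_config_sum//.
  rewrite (integral_start hC (G := fun s => \sum_(y <- s) mean_op p mu f y)).
    by rewrite big_seq1.
  by move=> s; apply: sum0 => y; exact: mean_op_ge0.
rewrite (markov_step (K := K) K_ge0 hC _ (G := fun s => \sum_(y <- s) f y))//;
  last by move=> s; exact: sum0.
under eq_integral do rewrite wsum_config_sum// mean_op_freeze//.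
rewrite IH ?iterSr// => y; rewrite /frozen_op; case: ifP => // _.
exact: mean_op_ge0.
Qed.

(** Off the null event [N] that the count drops at some step after time [1], the counts increase to
    [nu], and monotone convergence applies to their means. *)
Lemma integral_nu : \int[P]_w nu C x0 w = mean_returns p mu x0 x.
Proof.
pose A s t := (count_mem x0 t < count_mem x0 s)%N.
pose N := \bigcup_n [set w | A (C n.+1 w) (C n.+2 w)].
have AN n := prob_step_eq0 (K := K) K_ge0 hC (n := n.+1) (A := A).
have AK n s t : A s t -> K n.+1 s t = 0%R.
  rewrite /A ltnNge => st; apply/eqP; apply: contraNT st.
  exact: count_freeze_nd.
have mN : measurable N.
  by apply: bigcup_measurable => n _; have [] := AN n (AK n).
have PN : P N = 0.
  apply/negligibleP => //; apply: negligible_bigcup => n.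
  by have [mA A0] := AN n (AK n); apply/negligibleP.
pose f n w : \bar R := ((count_mem x0 (C n.+1 w))%:R)%:E.
have ndf w : ~ N w -> nondecreasing_seq (f^~ w).
  move=> Nw; apply/nondecreasing_seqP => n; rewrite lee_fin ler_nat leqNgt.
  by apply/negP => An; apply: Nw; exists n.
have fE n : \int[P]_w f n w = mean_op p mu (frozen p mu x0 n) x.
  rewrite -integral_sum_star; last by move=> y; exact: ind_ge0.
  by apply: eq_integral => w _; rewrite /f count_memE.
have mf n : measurable_fun setT (f n).
  exact: (measurable_fun_config hC n.+1 (fun s => ((count_mem x0 s)%:R)%:E)).
have f0 n w : 0 <= f n w by rewrite lee_fin ler0n.
have nu0 w : 0 <= nu C x0 w :> \bar R.
  by apply: limn_ge0 => n; rewrite lee_fin ler0n.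
have cf w : ~ N w -> f^~ w @ \oo --> nu C x0 w.
  move=> Nw; have cu := ereal_nondecreasing_cvgn (ndf w Nw).
  rewrite (_ : nu C x0 w = ereal_sup (range (f^~ w)))//.
  by apply/cvg_lim => //; rewrite -cvg_shiftS.
have /cvg_unique := integral_ae_limit mN PN mf f0 nu0 ndf cf; apply => //.
by rewrite (funext fE); exact/ereal_nondecreasing_cvgn/nd_returns.
Qed.

End frozen_process.

(** * Superharmonic functions imply transience *)

Section nondegenerate.
Context {R : realType} {X : countType}.
Variables (p : X -> X -> R) (mu : X -> nat -> R).
Hypotheses (hp : transition_matrix p) (hmu : offspring_laws mu).
Hypothesis irr : irreducible_chain p.
Variable f : X -> R.
Hypotheses (f_gt0 : forall x, 0 < f x)
  (f_superharmonic : forall x, (mean_op p mu (EFin \o f) x <= (f x)%:E)%E).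
Implicit Types (x y z : X) (t : seq X).

Definition expN x : R := expR (- f x).

Lemma unit_expN : unit_fun expN.
Proof.
move=> x; rewrite /expN expR_ge0 /= -[leRHS]expR0 ler_expR oppr_le0.
exact/ltW/f_gt0.
Qed.

Lemma prod_expN t : \prod_(y <- t) expN y = expR (- \sum_(y <- t) f y).
Proof.
elim: t => [|y t IH]; first by rewrite !big_nil oppr0 expR0.
by rewrite !big_cons IH opprD expRD.
Qed.

(** The slack in [1 + u <= expR u] at [u = f x - \sum_(y <- t) f y]; its mean measures the
    strictness in Jensen's inequality. *)
Definition jensen_gap x t : R :=
  expR (f x - \sum_(y <- t) f y) - (1 + (f x - \sum_(y <- t) f y)).

Lemma jensen_gap_ge0 x t : 0 <= jensen_gap x t.
Proof. by rewrite subr_ge0 expR_ge1Dx. Qed.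

(** The definition of [jensen_gap] is integrated over the litter, the mean of the litter weight [S]
    is bounded by [f x], and of the mean gap only the term of the litter [t] is kept. *)
Lemma gen_op_expN x t :
  expN x * (1 + litter_prob p mu x t * jensen_gap x t) <= gen_op p mu expN x.
Proof.
pose L := litter_prob p mu x.
have L0 := litter_ge0 hp hmu x.
pose S u := \sum_(y <- u) f y.
have S0 u : 0 <= S u by apply: sumr_ge0 => y _; exact: ltW.
(* The identity is arranged with nonnegative terms on both sides, so that additivity of [wsum]
   applies. *)
have : (wsum L (fun u => (expR (f x - S u))%:E + (S u)%:E) =
        wsum L (fun u => (1 + f x)%:E + (jensen_gap x u)%:E))%E.
  congr wsum; apply/funext => u; rewrite -!EFinD /jensen_gap -/(S u).
  by congr EFin; ring.
have e0 u : (0 <= (expR (f x - S u))%:E)%E by rewrite lee_fin expR_ge0.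
have SE0 u : (0 <= (S u)%:E)%E by rewrite lee_fin.
have f10 : (0 <= (1 + f x)%:E)%E by rewrite lee_fin addr_ge0// ltW.
have gap0 u : (0 <= (jensen_gap x u)%:E)%E by rewrite lee_fin jensen_gap_ge0.
rewrite !wsumD//.
have -> : (wsum L (fun u => (expR (f x - S u))%:E) =
    (expR (f x) * gen_op p mu expN x)%:E)%E.
  rewrite EFinM -(gen_opE hp hmu x unit_expN) -wsumZl ?lee_fin ?expR_ge0//.
    congr wsum; apply/funext => u; rewrite prod_expN -EFinM.
    by rewrite expRD.
  by move=> u; rewrite lee_fin prod_unit_ge0//; exact: unit_expN.
have -> : wsum L (fun=> (1 + f x)%:E) = (1 + f x)%:E.
  by rewrite wsum_cst ?wsum_litter1.
have SE : (wsum L (fun u => (S u)%:E) <= (f x)%:E)%E.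
  apply: le_trans (f_superharmonic x).
  rewrite -(wsum_litter_sum hp hmu); last by move=> y; rewrite lee_fin ltW.
  by apply: le_wsum => // u; rewrite sumEFin.
have gapE := wsum_ge_term L (fun u => (jensen_gap x u)%:E) t.
move=> E.
have : ((1 + f x)%:E + (L t * jensen_gap x t)%:E <=
    (expR (f x) * gen_op p mu expN x)%:E + (f x)%:E)%E.
  apply: (@le_trans _ _ ((1 + f x)%:E + wsum L (fun u => (jensen_gap x u)%:E))%E).
    by rewrite leeD2l// EFinM.
  by rewrite -E leeD2l.
rewrite -!EFinD lee_fin -/L => gap.
have {}gap : 1 + L t * jensen_gap x t <= expR (f x) * gen_op p mu expN x by lra.
rewrite /expN expRN; have ef0 := expR_gt0 (f x).
by rewrite ler_pdivrMl.
Qed.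

Lemma expN_le_gen_op x : expN x <= gen_op p mu expN x.
Proof.
apply: le_trans (gen_op_expN x [::]); rewrite ler_peMr ?expR_ge0//.
by rewrite lerDl mulr_ge0 ?jensen_gap_ge0// litter_ge0.
Qed.

Lemma jensen_gap_gt0 x t : \sum_(y <- t) f y != f x -> 0 < jensen_gap x t.
Proof.
move=> ft; rewrite subr_gt0 expR_gt1Dx// subr_eq0 eq_sym.
exact: ft.
Qed.

(* If no state had a nontrivial gap, every litter of [x] would have total weight
   exactly [f x]; then [f] is constant by irreducibility, and a state with two
   or more offspring gives a contradiction. *)
Lemma exists_gen_op_gt : (exists y, (1 < mean_offspring mu y)%E) ->
  exists z, expN z < gen_op p mu expN z.
Proof.
move=> [y0 my0]; apply: contrapT => nz.
have litterE x t : 0 < litter_prob p mu x t -> \sum_(y <- t) f y = f x.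
  move=> L0; apply/eqP; apply: contrapT => /negP ft; apply: nz; exists x.
  apply: lt_le_trans (gen_op_expN x t).
  by rewrite ltr_pMr ?expR_gt0// ltrDl mulr_gt0// jensen_gap_gt0.
have sum_nseq k y : \sum_(z <- nseq k y) f z = f y *+ k.
  by elim: k => [|k IH]; rewrite ?big_nil// big_cons IH mulrS.
have f_le x y : 0 < p x y -> f y <= f x.
  move=> /(litter_nseq_pos hmu)[[//|k] _ /litterE <-].
  by rewrite sum_nseq mulrS lerDl mulrn_wge0// ltW.
have f_cst x y : f y <= f x.
  apply: (irreducible_ind hp irr (A := fun x => f y <= f x) (y := y)) => //.
  by move=> u z /f_le zu /le_trans; apply.
have [k k2 muk] : exists2 k, (2 <= k)%N & 0 < mu y0 k.
  apply: contrapT => nk; move: my0; rewrite ltNge => /negP; apply.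
  rewrite -(wsum_mu1 hmu y0) mean_offspringE//; apply: le_esum => k _.
  have [k1|k2] := leqP k 1.
    by rewrite lee_wpmul2l ?lee_fin ?mu_ge0// lern1.
  have -> : mu y0 k = 0; last by rewrite !mul0e.
  apply/eqP; apply: contrapT => /negP muk; apply: nk; exists k => //.
  by rewrite lt_neqAle eq_sym muk mu_ge0.
have [y py] := step_pos hp y0.
have Lpos : 0 < litter_prob p mu y0 (nseq k y).
  by rewrite /litter_prob size_nseq mulr_gt0// prod_nseq exprn_gt0.
have := litterE _ _ Lpos; rewrite sum_nseq => fk.
have := f_cst y y0; rewrite -fk leNgt => /negP; apply.
by rewrite -[ltLHS]mulr1n ltr_pMn2l.
Qed.

Let unit_iter j : unit_fun (iter j (gen_op p mu) expN) :=
  unit_iter_gen_op hp hmu j unit_expN.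

Lemma iter_gen_op_nd j x :
  iter j (gen_op p mu) expN x <= iter j.+1 (gen_op p mu) expN x.
Proof.
elim: j x => [|j IH] x; first exact: expN_le_gen_op.
apply: (le_gen_op hp hmu) => //; first exact: unit_iter.
exact: (unit_iter j.+1).
Qed.

Lemma expN_le_iter_gen_op j x : expN x <= iter j (gen_op p mu) expN x.
Proof.
by elim: j => [//|j IH]; apply: le_trans IH _; exact: iter_gen_op_nd.
Qed.

(** Strictness at [y] on level [j] gives strictness on level [j + 1] at each predecessor of [y]. *)
Lemma exists_iter_gen_op_gt : (exists y, (1 < mean_offspring mu y)%E) ->
  forall x, exists j,
    iter j (gen_op p mu) expN x < iter j.+1 (gen_op p mu) expN x.
Proof.
move=> /exists_gen_op_gt[z hz].
apply: (@irreducible_ind _ _ _ hp irr (fun x => exists j,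
  iter j (gen_op p mu) expN x < iter j.+1 (gen_op p mu) expN x) z).
  move=> x y pxy [j hj]; exists j.+1.
  apply: (lt_gen_op hp hmu (y := y)) => //.
  - exact: unit_iter.
  - exact: (unit_iter j.+1).
  - exact: iter_gen_op_nd.
by exists 0%N.
Qed.

End nondegenerate.

(** * Moments and a maximal inequality for the branching process *)

Section branching_process.
Context {R : realType} {X : countType}.
Variables (p : X -> X -> R) (mu : X -> nat -> R).
Hypotheses (hp : transition_matrix p) (hmu : offspring_laws mu).
Variable xs : X.
Context d (Omega : measurableType d) (P : probability Omega R).
Variable C : nat -> Omega -> seq X.
Hypothesis hC : is_BMC p mu xs P C.
Local Open Scope ereal_scope.

Let K_ge0 : forall n : nat, forall s t, (0 <= config_step p mu s t)%R.
Proof. by move=> _; exact: config_step_ge0. Qed.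

Lemma integral_prod_config n (h : X -> R) : unit_fun h ->
  \int[P]_w (\prod_(y <- C n w) h y)%R%:E = (iter n (gen_op p mu) h xs)%:E.
Proof.
elim: n h => [|n IH] h uh.
  rewrite (integral_start hC (G := fun s => (\prod_(y <- s) h y)%R%:E)).
    by rewrite big_seq1.
  by move=> s; rewrite lee_fin prod_unit_ge0.
rewrite (markov_step K_ge0 hC n (G := fun s => (\prod_(y <- s) h y)%R%:E)).
  under eq_integral do rewrite wsum_config_prod//.
  by rewrite IH ?iterSr//; exact: unit_gen_op.
by move=> s; rewrite lee_fin prod_unit_ge0.
Qed.

Lemma integral_sum_config n (f : X -> \bar R) : (forall y, 0 <= f y) ->
  \int[P]_w (\sum_(y <- C n w) f y) = iter n (mean_op p mu) f xs.
Proof.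
elim: n f => [|n IH] f f0.
  rewrite (integral_start hC (G := fun s => \sum_(y <- s) f y)).
    by rewrite big_seq1.
  by move=> s; apply: sume_ge0.
rewrite (markov_step K_ge0 hC n (G := fun s => \sum_(y <- s) f y)).
  under eq_integral do rewrite wsum_config_sum//.
  by rewrite IH ?iterSr//; exact: mean_op_ge0.
by move=> s; apply: sume_ge0.
Qed.

Lemma measurable_visits x : measurable [set w | visits C x w = +oo :> \bar R].
Proof.
have mv : measurable_fun setT (visits C x : Omega -> \bar R).
  rewrite /visits; under eq_fun do rewrite eseries_cond.
  apply: ge0_emeasurable_sum => [k w _ _|k _]; first by rewrite lee_fin ler0n.
  exact: (measurable_fun_config hC k (fun s => ((count_mem x s)%:R)%:E)).
rewrite -[X in measurable X]setTI; exact: (mv measurableT [set +oo]).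
Qed.

Section maximal_inequality.
Variables (f : X -> R) (b : R).
Hypotheses (f_ge0 : forall x, (0 <= f x)%R) (b_gt0 : (0 < b)%R)
  (f_superharmonic : forall x, mean_op p mu (EFin \o f) x <= (f x)%:E).

Let Phi (s : seq X) : R := (\sum_(y <- s) f y)%R.
Let below (l : seq (seq X)) : bool := all (fun s => Phi s < b)%R l.
(* The total weight, stopped at level [b] once it has reached [b]. *)
Let stopped l s : R := if below l then Phi s else b.

Let Phi_ge0 s : (0 <= Phi s)%R. Proof. exact: sumr_ge0. Qed.

Let stopped_ge0 l s : 0 <= (stopped l s)%:E.
Proof. by rewrite lee_fin /stopped; case: ifP => // _; exact: ltW. Qed.

(** While the past is below [b], the weight is a supermartingale. A value of at least [b] is
    replaced by [b] one step later, which does not increase it, and then stays constant. *)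
Let stopped_supermartingale n :
  \int[P]_w (stopped (history C n w) (C n w))%:E <= (f xs)%:E.
Proof.
elim: n => [|n IH].
  rewrite (integral_start hC (G := fun s => (stopped [::] s)%:E)).
    by rewrite /stopped /= /Phi big_seq1.
  by move=> s; exact: stopped_ge0.
rewrite (markov_property K_ge0 hC n (F := fun l s => (stopped l s)%:E))//.
apply: le_trans IH; apply: ge0_le_integral_nonmeasurable => w.
  by apply: wsum_ge0 => //; exact: config_step_ge0.
rewrite /history mkseqS -/(history C n w); set l := history C n w.
rewrite {1}/stopped /below all_rcons -/(below l).
have csum s : wsum (config_step p mu s) (fun t => (Phi t)%:E) <= (Phi s)%:E.
  rewrite /Phi -sumEFin; under eq_wsum do rewrite -sumEFin.
  rewrite (wsum_config_sum hp hmu s (f := EFin \o f)); last first.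
    by move=> y; rewrite lee_fin.
  exact: lee_sum.
have cstb s : wsum (config_step p mu s) (fun=> b%:E) = b%:E.
  apply: wsum_cst; first exact: config_step_ge0.
    exact: wsum_config1.
  by rewrite lee_fin ltW.
rewrite /stopped; have [bPhi|bPhi] := ltP (Phi (C n w)) b => /=.
  by case: (below l) => //; rewrite cstb.
by rewrite cstb; case: (below l); rewrite lee_fin.
Qed.

(** On [E n] the stopped weight equals [b], so [b * P (E n)] is at most its mean; the events [E n]
    increase to the one in question. *)
Lemma maximal_inequality :
  measurable [set w | exists n, (b <= \sum_(y <- C n w) f y)%R] /\
  P [set w | exists n, (b <= \sum_(y <- C n w) f y)%R] <= (f xs / b)%:E.
Proof.
pose E n := [set w | ~~ below (history C n w)].
have belowS n w : below (history C n.+1 w) =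
    (Phi (C n w) < b)%R && below (history C n w).
  by rewrite /history mkseqS /below all_rcons.
have mE n : measurable (E n).
  exact: (measurable_countable_preimage (measurable_history hC n)
    (fun l => ~~ below l)).
have -> : [set w | exists n, (b <= \sum_(y <- C n w) f y)%R] = \bigcup_n E n.
  apply/seteqP; split => [w [n bn]|w [n _]].
    by exists n.+1 => //; rewrite /E /mkset belowS negb_and -leNgt bn.
  rewrite /E /= /below -has_predC => /hasP[s /mapP[i _ ->]] /=.
  by rewrite -leNgt => bi; exists i.
split; first exact: bigcup_measurable.
have ndE : {homo E : n m / (n <= m)%N >-> (n <= m)%O}.
  apply/nondecreasing_seqP => n; apply/subsetPset => w.
  by rewrite /E /mkset belowS => /negPf ->; rewrite andbF.
have := nondecreasing_cvg_mu (mu := P) mE (bigcup_measurable (fun n _ => mE n)) ndE.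
move=> cE; rewrite -(cvg_lim _ cE)//; apply: lime_le.
  by apply/cvg_ex; exists (P (\bigcup_n E n)).
apply: nearW => n /=; rewrite EFinM lee_pdivlMr//.
apply: le_trans (stopped_supermartingale n).
rewrite -(prob_countable P (measurable_history hC n) (fun l => ~~ below l)).
have b0 : 0 <= b%:E by rewrite lee_fin ltW.
have mB := measurable_fun_countable (measurable_history hC n)
    (fun l => ((~~ below l)%:R)%:E).
have B0 w : 0 <= ((~~ below (history C n w))%:R)%:E :> \bar R.
  by rewrite lee_fin ler0n.
rewrite muleC -ge0_integralZl//=.
apply: ge0_le_integral_nonmeasurable => w.
  exact: mule_ge0.
rewrite /stopped; case: (below _) => /=; first by rewrite mule0 lee_fin.
by rewrite mule1.
Qed.

End maximal_inequality.
End branching_process.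

(** * Finitely many visits under a superharmonic function *)

Section recurrence.
Context {R : realType} {X : countType}.
Variables (p : X -> X -> R) (mu : X -> nat -> R).
Hypotheses (hp : transition_matrix p) (hmu : offspring_laws mu).
Variable xs : X.
Context d (Omega : measurableType d) (P : probability Omega R).
Variable C : nat -> Omega -> seq X.
Hypothesis hC : is_BMC p mu xs P C.
Local Open Scope ereal_scope.

Local Notation T := (gen_op p mu).

(** Each particle at [x] contributes a factor of at least [1 + delta], and Bernoulli's inequality
    bounds the product of these factors below. *)
Lemma prod_gen_op_ge (h : X -> R) x (delta : R) s : unit_fun h ->
  (forall y, h y <= T h y)%R -> (0 < delta)%R ->
  (h x * (1 + delta) <= T h x)%R ->
  (\prod_(y <- s) h y * (1 + delta * (count_mem x s)%:R) <=
   \prod_(y <- s) T h y)%R.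
Proof.
move=> uh hT d0 hx; have uT := unit_gen_op hp hmu uh.
elim: s => [|y s IH]; first by rewrite !big_nil mulr0 addr0 mulr1.
rewrite !big_cons /=; set c := (count_mem x s)%:R : R.
have H0 : (0 <= \prod_(z <- s) h z)%R by exact: prod_unit_ge0.
have dc0 : (0 <= delta * c)%R by rewrite mulr_ge0 ?ler0n// ltW.
have hy0 := unit_fun_ge0 y uh.
apply: (@le_trans _ _ (T h y * (\prod_(z <- s) h z * (1 + delta * c)))%R); last first.
  by apply: ler_wpM2l IH; exact: unit_fun_ge0.
rewrite -mulrA [leRHS]mulrCA [leLHS]mulrCA; apply: ler_wpM2l => //.
have [->|_] /= := eqVneq y x; last first.
  by rewrite add0n -/c; apply: ler_wpM2r; [rewrite addr_ge0|exact: hT].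
apply: le_trans (ler_wpM2r (_ : 0 <= 1 + delta * c)%R hx); last by rewrite addr_ge0.
rewrite natrD -/c -mulrA; apply: ler_wpM2l; first exact: unit_fun_ge0.
have : (0 <= delta * (delta * c))%R by rewrite mulr_ge0// ltW.
by move=> dd; rewrite mulrDr mulrDl; nra.
Qed.

(** The means [iter n T h xs] of the products never exceed [1], and step [n] raises them by at least
    [delta] times the [n]-th integral; the sum telescopes. *)
Lemma summable_visits (h : X -> R) x (delta : R) : unit_fun h ->
  (forall y, h y <= T h y)%R -> (0 < delta)%R ->
  (h x * (1 + delta) <= T h x)%R ->
  \int[P]_w (\sum_(n <oo) (\prod_(y <- C n w) h y * (count_mem x (C n w))%:R)%:E)
    <= (delta^-1)%:E.
Proof.
move=> uh hT d0 hx.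
pose G s : R := (\prod_(y <- s) h y * (count_mem x s)%:R)%R.
have G0 s : 0 <= (G s)%:E by rewrite lee_fin mulr_ge0 ?ler0n// prod_unit_ge0.
have H0 s : 0 <= (\prod_(y <- s) h y)%R%:E by rewrite lee_fin prod_unit_ge0.
have mG n := measurable_fun_config hC n (fun s => (G s)%:E).
have mH n := measurable_fun_config hC n (fun s => (\prod_(y <- s) h y)%R%:E).
rewrite (integral_nneseries P measurableT (f := fun n w => (G (C n w))%:E))//.
have mdG n := measurable_fun_config hC n (fun s => delta%:E * (G s)%:E).
have d0E : 0 <= delta%:E by rewrite lee_fin ltW.
have dG0 s : 0 <= delta%:E * (G s)%:E by exact: mule_ge0.
have step n : (iter n T h xs)%:E + delta%:E * \int[P]_w (G (C n w))%:E <=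
    (iter n.+1 T h xs)%:E.
  rewrite iterSr -(integral_prod_config hp hmu hC n uh).
  rewrite -(integral_prod_config hp hmu hC n (unit_gen_op hp hmu uh)).
  have -> : delta%:E * \int[P]_w (G (C n w))%:E =
      \int[P]_w (delta%:E * (G (C n w))%:E).
    by rewrite ge0_integralZl//; exact: mG.
  have <- : \int[P]_w ((\prod_(y <- C n w) h y)%R%:E + delta%:E * (G (C n w))%:E) =
      \int[P]_w (\prod_(y <- C n w) h y)%R%:E + \int[P]_w (delta%:E * (G (C n w))%:E).
    by rewrite ge0_integralD//; [exact: mH|exact: mdG].
  apply: ge0_le_integral_nonmeasurable => w; first exact: adde_ge0.
  rewrite -EFinM -EFinD lee_fin; apply: le_trans (prod_gen_op_ge _ uh hT d0 hx).
  by rewrite /G mulrDr mulr1 mulrCA.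
have uiter n : unit_fun (iter n T h) by exact: unit_iter_gen_op.
have part n : delta%:E * \sum_(0 <= i < n) \int[P]_w (G (C i w))%:E <=
    (iter n T h xs)%:E.
  elim: n => [|n IH].
    by rewrite big_nil mule0 lee_fin (unit_fun_ge0 _ (uiter 0%N)).
  rewrite big_nat_recr//= ge0_muleDr ?sume_ge0//; last 2 first.
  - by move=> i _; exact: integral_ge0.
  - exact: integral_ge0.
  by apply: le_trans (step n); rewrite leeD2r.
apply: lime_le; first by apply: is_cvg_nneseries => n _ _; exact: integral_ge0.
apply: nearW => n; rewrite -[leRHS]mule1 lee_pdivlMl//.
by apply: le_trans (part n) _; rewrite lee_fin; exact: unit_fun_le1.
Qed.

Lemma visits_finite (f : X -> R) x : irreducible_chain p ->
  (exists y, 1 < mean_offspring mu y) -> (forall y, 0 < f y)%R ->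
  (forall y, mean_op p mu (EFin \o f) y <= (f y)%:E) ->
  P [set w | visits C x w = +oo :> \bar R] = 0.
Proof.
move=> irr hy f0 Mf.
have [j hj] := exists_iter_gen_op_gt hp hmu irr f0 Mf hy x.
pose h := iter j T (expN f).
have uh : unit_fun h by exact/unit_iter_gen_op/unit_expN.
have hT y : (h y <= T h y)%R by exact: (iter_gen_op_nd hp hmu f0 Mf j).
have hexp y : (expN f y <= h y)%R by exact: expN_le_iter_gen_op.
have hx0 : (0 < h x)%R by apply: lt_le_trans (hexp x); exact: expR_gt0.
pose delta := (T h x / h x - 1)%R.
have d0 : (0 < delta)%R by rewrite subr_gt0 ltr_pdivlMr// mul1r.
have hxd : (h x * (1 + delta) <= T h x)%R.
  by rewrite addrC subrK mulrC divfK// gt_eqF.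
have intV := summable_visits uh hT d0 hxd.
pose g n w : \bar R := (\prod_(y <- C n w) h y * (count_mem x (C n w))%:R)%:E.
have g0 n w : 0 <= g n w by rewrite lee_fin mulr_ge0 ?ler0n// prod_unit_ge0.
pose V w : \bar R := \sum_(n <oo) g n w.
have V0 w : 0 <= V w by apply: nneseries_ge0.
have mV : measurable_fun setT V.
  apply: ge0_emeasurable_sum => // n _.
  exact: (measurable_fun_config hC n
    (fun s => (\prod_(y <- s) h y * (count_mem x s)%:R)%:E)).
have mVoo : measurable [set w | V w = +oo].
  by rewrite -[X in measurable X]setTI; exact: (mV measurableT [set +oo]).
have PV : P [set w | V w = +oo] = 0.
  apply: measure_negligible => //.
  have iV : P.-integrable setT V.
    apply/integrableP; split => //.
    under eq_integral do rewrite gee0_abs//.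
    exact: le_lt_trans intV (ltry _).
  have := integrable_ae measurableT iV; apply: negligibleS => w /= -> /(_ I).
  by [].
have mvis := measurable_visits hC x.
(* Apart from the null event [V = +oo], infinitely many visits to [x] require that the total weight
   reaches every level [b]. *)
have bound b : (0 < b)%R -> P [set w | visits C x w = +oo :> \bar R] <= (f xs / b)%:E.
  move=> b0.
  have [mE PE] := maximal_inequality hp hmu hC (fun y => ltW (f0 y)) b0 Mf.
  apply: le_trans PE.
  set E := [set w | exists n, _] in mE *.
  apply: (@le_trans _ _ (P ([set w | V w = +oo] `|` E))).
    apply: le_measure; rewrite ?inE//.
      exact: measurableU.
    move=> w /= visw; have [Ew|nEw] := pselect (E w); [by right|left].
    have PhiC n : (\sum_(y <- C n w) f y < b)%R.
      by rewrite ltNge; apply/negP => bn; apply: nEw; exists n.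
    have HC n : (expR (- b) <= \prod_(y <- C n w) h y)%R.
      apply: (@le_trans _ _ (\prod_(y <- C n w) expN f y)%R).
        by rewrite prod_expN ler_expR lerN2 ltW.
      by apply: le_prod_unit => //; exact: unit_expN.
    (* As long as the weight stays below [b], each product of [h] is at least [expR (- b)], so [V]
       controls the visits. *)
    have : visits C x w <= (expR b)%:E * V w.
      rewrite -nneseriesZl//.
      apply: (@le_trans _ _ (\sum_(1 <= n <oo) ((expR b)%:E * g n w))).
        apply: lee_nneseries => [n _ _|n _]; first by rewrite lee_fin ler0n.
        rewrite /g -EFinM lee_fin mulrA ler_peMl ?ler0n//.
        by have := HC n; rewrite expRN -[leLHS]mulr1 ler_pdivrMl ?expR_gt0.
      rewrite [leRHS]nneseries_recl//; last first.
        by move=> n _; rewrite mule_ge0// lee_fin expR_ge0.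
      by rewrite leeDr// mule_ge0// lee_fin expR_ge0.
    by rewrite visw leye_eq; move: (V0 w); case: (V w) => [r _ /eqP| |].
  apply: le_trans (measureU2 P mVoo mE) _; rewrite -[leRHS]add0e leeD//.
  by move/eqP: PV; rewrite eq_le => /andP[].
apply/eqP; rewrite eq_le measure_ge0 andbT leNgt; apply/negP => P0.
have Pfin : P [set w | visits C x w = +oo :> \bar R] \is a fin_num.
  exact: fin_num_measure.
move: bound P0; rewrite -(fineK Pfin); set r := fine _ => bound; rewrite lte_fin => r0.
(* This level turns the bound into [r <= r / 2]. *)
have := bound (2 * f xs / r)%R; rewrite lee_fin.
have -> : (f xs / (2 * f xs / r) = r / 2)%R.
  by field; rewrite !gt_eqF.
have b0 : (0 < 2 * f xs / r)%R by rewrite divr_gt0// mulr_gt0.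
by move=> /(_ b0) ?; lra.
Qed.


End recurrence.

(** * Supercritical returns imply recurrence *)

Section supercritical.
Context {R : realType} {X : countType}.
Variables (p : X -> X -> R) (mu : X -> nat -> R).
Hypotheses (hp : transition_matrix p) (hmu : offspring_laws mu).
Variable x0 : X.
Context d (Omega : measurableType d) (P : probability Omega R).
Variable C : nat -> Omega -> seq X.
Hypothesis hC : is_BMC p mu x0 P C.

Local Notation T := (gen_op p mu).

(** A second-order lower bound for the probability that at least one of [c] independent marks of
    probability [e] occurs. *)
Lemma expr_one_minus_le (e : R) c : 0 <= e <= 1 ->
  e * (c%:R * (1 - e * c%:R)) <= 1 - (1 - e) ^+ c.
Proof.
move=> /andP[e0 e1].
suff : (1 - e) ^+ c <= 1 - c%:R * e + (c%:R * e) ^+ 2 by nra.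
elim: c => [|c IH]; first by rewrite expr0 !mul0r expr2 mulr0 subr0 addr0.
rewrite exprS; apply: (le_trans (ler_wpM2l _ IH)); first by rewrite subr_ge0.
rewrite -natr1; set k : R := c%:R; have k0 : 0 <= k by rewrite ler0n.
have ek : 0 <= e * k by rewrite mulr_ge0.
rewrite -subr_ge0.
have -> : 1 - (k + 1) * e + ((k + 1) * e) ^+ 2 -
    (1 - e) * (1 - k * e + (k * e) ^+ 2) =
  e * (e * k) + e * e + e * (e * k * (e * k)) by ring.
by rewrite !addr_ge0// !mulr_ge0.
Qed.

(** If each particle at [x0] is marked with probability [e], the product of [thin e] over a
    configuration is the probability that none is marked; [e = 1] gives the indicator that [x0] is
    vacant. *)
Definition thin (e : R) y : R := if y == x0 then 1 - e else 1.

Lemma unit_thin e : 0 <= e <= 1 -> unit_fun (thin e).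
Proof.
move=> /andP[e0 e1] y; rewrite /thin; case: ifP => _; last by rewrite ler01 lexx.
by rewrite subr_ge0 e1 lerBlDr lerDl.
Qed.

Lemma prod_thin e s : \prod_(y <- s) thin e y = (1 - e) ^+ count_mem x0 s.
Proof.
elim: s => [|y s IH]; first by rewrite big_nil.
by rewrite big_cons IH /thin /=; case: ifP; rewrite ?mul1r// exprS.
Qed.

(** A finite list [r] of configurations already carries a mean count [A > 1]. On [r] the counts are
    at most [L], so the marking probability is at least [e * (1 - e * L) * A], which is at least [e]
    for small [e]. *)
Lemma exists_thin k : (1 < iter k (mean_op p mu) (ind x0) x0)%E ->
  exists e : R, [/\ 0 < e, e <= 1 & iter k T (thin e) x0 <= 1 - e].
Proof.
rewrite -(integral_sum_config hp hmu hC); last by move=> y; exact: ind_ge0.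
have mC := measurable_config hC k.
rewrite (integral_countable P mC (G := fun s => (\sum_(y <- s) ind x0 y)%E));
  last by move=> s; apply: sume_ge0 => y _; exact: ind_ge0.
set q := mass P (C k) => gt1; have q0 s : 0 <= q s by exact: mass_ge0.
have [r ur rA] : exists2 r : seq (seq X), uniq r &
    (1 < \sum_(s <- r) q s * (count_mem x0 s)%:R).
  apply: contrapT => nr; move: gt1; rewrite ltNge => /negP; apply.
  apply: esumT_le => r ur; rewrite leNgt; apply/negP => rA; apply: nr.
  exists r => //; rewrite -lte_fin -sumEFin; apply: lt_le_trans rA _.
  by apply: lee_sum => s _; rewrite -count_memE EFinM.
set A := \sum_(s <- r) _ in rA.
pose L : R := \sum_(s <- r) (count_mem x0 s)%:R.
have L0 : 0 <= L by apply: sumr_ge0 => s _; exact: ler0n.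
have A0 : 0 < A by rewrite (lt_trans _ rA).
(* Chosen so that [e * L <= 1 - A^-1]; the [+ 1] keeps the denominator positive and yields
   [e <= 1]. *)
pose e := (1 - A^-1) / (L + 1).
have Ai : 0 < A^-1 < 1 by rewrite invr_gt0 A0 invf_lt1.
have L1 : 0 < L + 1 by rewrite ltr_wpDl.
have e0 : 0 < e by rewrite divr_gt0// subr_gt0; case/andP: Ai.
have eL : e * (L + 1) = 1 - A^-1 by rewrite divfK// gt_eqF.
have e1 : e <= 1 by nra.
have e01 : 0 <= e <= 1 by rewrite ltW.
have eA : 1 <= (1 - e * L) * A.
  have : A^-1 <= 1 - e * L by nra.
  by rewrite -[A^-1]mul1r ler_pdivrMr.
have ut := unit_thin e01.
exists e; split => //; rewrite -lee_fin.
have H0 s : (0 <= (\prod_(y <- s) thin e y)%:E)%E by rewrite lee_fin prod_unit_ge0.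
have H1 s : (0 <= (1 - \prod_(y <- s) thin e y)%:E)%E.
  by rewrite lee_fin subr_ge0; case/andP: (prod_unit s ut).
have total : (wsum q (fun s => (\prod_(y <- s) thin e y)%:E) +
              wsum q (fun s => (1 - \prod_(y <- s) thin e y)%:E) = 1)%E.
  rewrite -wsumD// -(integral_countable P mC (G := fun s =>
    ((\prod_(y <- s) thin e y)%:E + (1 - \prod_(y <- s) thin e y)%:E)%E)); last first.
    by move=> s; rewrite adde_ge0.
  under eq_integral do rewrite -EFinD addrC subrK.
  by rewrite integral_cst// mul1e; exact: probability_setT.
rewrite -(integral_prod_config hp hmu hC k ut).
rewrite (integral_countable P mC (G := fun s => (\prod_(y <- s) thin e y)%:E))//.
have We : (e%:E <= wsum q (fun s => (1 - \prod_(y <- s) thin e y)%:E))%E.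
  apply: le_trans (le_seq_esumT _ ur); rewrite -/q.
  under eq_bigr do rewrite -EFinM; rewrite sumEFin lee_fin.
  apply: (@le_trans _ _ (e * ((1 - e * L) * A))); first by rewrite ler_peMr// ltW.
  rewrite /A mulrA mulr_sumr big_seq [leRHS]big_seq; apply: ler_sum => s sr.
  rewrite prod_thin mulrCA; apply: ler_wpM2l => //.
  apply: le_trans (expr_one_minus_le (count_mem x0 s) e01).
  rewrite -mulrA; apply: ler_wpM2l; first exact: ltW.
  rewrite mulrC; apply: ler_wpM2l; first exact: ler0n.
  rewrite lerD2l lerN2; apply: ler_wpM2l; first exact: ltW.
  rewrite /L (perm_big _ (perm_to_rem sr)) big_cons lerDl.
  by apply: sumr_ge0 => ? _; exact: ler0n.
have Wfin : (wsum q (fun s => (\prod_(y <- s) thin e y)%:E) \is a fin_num)%E.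
  rewrite ge0_fin_numE; last by apply: wsum_ge0.
  apply: (@le_lt_trans _ _ 1%E); last exact: ltry.
  by rewrite -total leeDl// wsum_ge0.
rewrite EFinB leeBrDr//.
by rewrite -total leeD2l.
Qed.

Local Open Scope ereal_scope.

Lemma visits_infinite k : 1 < iter k (mean_op p mu) (ind x0) x0 ->
  P [set w | visits C x0 w = +oo :> \bar R] != 0.
Proof.
move=> gt1; have [e [e0 e1 Te]] := exists_thin gt1.
(* Since [k] is positive, the times [j * k] are unbounded. *)
have k0 : (0 < k)%N by case: k gt1 {Te} => //; rewrite /= /ind eqxx ltxx.
have ut : unit_fun (thin e) by apply: unit_thin; rewrite ltW.
have Tk j y : (iter (j * k) T (thin e) y <= thin e y)%R.
  elim: j y => [//|j IH] y; rewrite mulSn iterD.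
  apply: (@le_trans _ _ (iter k T (thin e) y)).
    by apply: (le_iter_gen_op hp hmu) => //; exact: unit_iter_gen_op.
  have [->|yx0] := eqVneq y x0; first by rewrite {2}/thin eqxx.
  by rewrite {2}/thin (negPf yx0); exact/unit_fun_le1/unit_iter_gen_op.
pose E n := [set w | x0 \in C n w].
have mE n : measurable (E n).
  exact: (measurable_countable_preimage (measurable_config hC n) (fun s => x0 \in s)).
have u0 : unit_fun (thin 1) by apply: unit_thin; rewrite ler01 lexx.
(* The vacancy indicator, the product of [thin 1], is at most the product of [thin e], whose mean at
   time [j * k] is at most [1 - e]. *)
have PE j : e%:E <= P (E (j * k)%N).
  have -> : E (j * k)%N = ~` [set w | x0 \notin C (j * k)%N w].
    apply/seteqP; split => w; rewrite /E /=; first by move=> ->.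
    by move/negP; rewrite negbK.
  rewrite probability_setC; last first.
    exact: (measurable_countable_preimage (measurable_config hC _)
      (fun s => x0 \notin s)).
  rewrite -(prob_config hC (j * k) (fun s => x0 \notin s)).
  have -> : \int[P]_w ((x0 \notin C (j * k)%N w)%:R)%:E =
      \int[P]_w (\prod_(y <- C (j * k)%N w) thin 1 y)%R%:E.
    apply: eq_integral => w _; rewrite prod_thin subrr expr0n.
    by rewrite -has_pred1 has_count -eqn0Ngt.
  rewrite (integral_prod_config hp hmu hC)// -EFinB lee_fin lerBrDr.
  have : (iter (j * k) T (thin 1) x0 <= thin e x0)%R.
    apply: le_trans (Tk j x0); apply: (le_iter_gen_op hp hmu) => // y.
    by rewrite /thin; case: ifP => // _; rewrite lerD2l lerN2.
  by rewrite {2}/thin eqxx; lra.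
(* Continuity from above bounds the probability of the limsup of the events [E n] below by [e]. *)
pose F N := \bigcup_(n in [set n | (N <= n)%N]) E n.
have mF N : measurable (F N) by apply: bigcup_measurable.
have mFF : measurable (\bigcap_N F N) by apply: bigcap_measurable.
have niF : nonincreasing_seq F.
  move=> m n mn; apply/subsetPset => w [i /= ni Ei].
  by exists i => //=; exact: leq_trans ni.
have PF N : e%:E <= P (F N).
  apply: le_trans (PE N) _; apply: le_measure; rewrite ?inE//.
  by move=> w Ew; exists (N * k)%N => //=; exact: leq_pmulr.
have PFF : e%:E <= P (\bigcap_N F N).
  have F0 : P (F 0%N) < +oo by rewrite ltey_eq fin_num_measure.
  have cF := nonincreasing_cvg_mu F0 mF mFF niF.
  rewrite -(cvg_lim _ cF)//; apply: lime_ge.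
    by apply/cvg_ex; exists (P (\bigcap_N F N)).
  by apply: nearW => N; exact: PF.
have sub : \bigcap_N F N `<=` [set w | visits C x0 w = +oo :> \bar R].
  move=> w Fw /=.
  pose c n : R := (count_mem x0 (C n w))%:R.
  have part Q : exists2 m, (0 < m)%N & (Q%:R <= \sum_(1 <= n < m) c n)%R.
    elim: Q => [|Q [m m0 IH]]; first by exists 1%N; rewrite // big_geq.
    have [n /= mn Ewn] := Fw m I; exists n.+1 => //.
    rewrite big_nat_recr//=; last exact: leq_trans mn.
    rewrite -natr1 lerD//; last by rewrite /c ler1n -has_count has_pred1.
    apply: le_trans IH _; rewrite [leRHS](big_cat_nat (n := m))//=.
    by rewrite lerDl; apply: sumr_ge0 => i _; exact: ler0n.
  apply/eqyP => A A0; have [m m0 cm] := part (Num.truncn A).+1.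
  apply: (@le_trans _ _ (\sum_(1 <= n < m) (c n)%:E)).
    by rewrite sumEFin lee_fin; apply: le_trans cm; exact/ltW/truncnS_gt.
  by apply: nneseries_lim_ge => i _ _; rewrite lee_fin ler0n.
have Ppos : 0 < P [set w | visits C x0 w = +oo :> \bar R].
  apply: lt_le_trans (_ : 0 < e%:E) _; first by rewrite lte_fin.
  apply: le_trans PFF _; apply: le_measure; rewrite ?inE//.
  exact: (measurable_visits hC).
by rewrite gt_eqF.
Qed.

End supercritical.

(** * The equivalences *)

Lemma superharmonicE (R : realType) (X : countType) (p : X -> X -> R)
    (mu : X -> nat -> R) (f : X -> R) (x : X) :
  offspring_laws mu -> (mean_offspring mu x < +oo)%E ->
  (markov_op p f x <= (f x / fine (mean_offspring mu x))%:E)%E =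
  (mean_op p mu (EFin \o f) x <= (f x)%:E)%E.
Proof.
move=> hmu hm; have m1 := mean_offspring_ge1 hmu x.
have mfin : mean_offspring mu x \is a fin_num.
  by rewrite ge0_fin_numE// (le_trans _ m1).
have m0 : 0 < fine (mean_offspring mu x).
  by rewrite -lte_fin fineK// (lt_le_trans _ m1).
rewrite EFinM lee_pdivlMr// fineK// muleC; congr (_ * _ <= _)%E.
Qed.

Theorem theorem2p3 (R : realType) (X : countType)
    (infX : infinite_set [set: X])
    (p : X -> X -> R) (hp : transition_matrix p) (irr : irreducible_chain p)
    (mu : X -> nat -> R) (hmu : offspring_laws mu)
    (hm : forall x, (mean_offspring mu x < +oo)%E)
    (hy : exists y, (1 < mean_offspring mu y)%E)
    (d : measure_display) (Omega : measurableType d)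
    (Pr : X -> probability Omega R) (C : nat -> Omega -> seq X)
    (hC : forall x, is_BMC p mu x (Pr x) C)
    (d' : measure_display) (Omega' : measurableType d')
    (Pr' : X -> X -> probability Omega' R) (C' : nat -> Omega' -> seq X)
    (hC' : forall x0 x, is_BMC_star p mu x0 x (Pr' x0 x) C') :
  [/\ transient Pr C <-> (exists x, (mean_nu Pr' C' x x <= 1)%E),
      transient Pr C <-> (forall x, (mean_nu Pr' C' x x <= 1)%E),
      transient Pr C <-> (forall x x0, (mean_nu Pr' C' x0 x < +oo)%E) &
      transient Pr C <->
        (exists f : X -> R,
           (forall x, 0 < f x) /\
           (forall x,
              (markov_op p f x <= (f x / fine (mean_offspring mu x))%:E)%E))].
Proof.
have nuE x0 x : mean_nu Pr' C' x0 x = mean_returns p mu x0 x.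
  by rewrite /mean_nu (integral_nu hp hmu (hC' x0 x)).
have [y0 _] := hy.
set Tr := transient Pr C.
set I1 := exists x, _; set I2 := forall x, _; set II := forall x x0, _.
set III := exists f : X -> R, _.
(* The implications form the cycle [I1], [III], [Tr], [I2], [I1], with a detour from [III] to [I2]
   through [II]. *)
have I1_III : I1 -> III.
  move=> [x]; rewrite nuE => /(superharmonic_of_returns_le1 hp hmu hm irr).
  by move=> [f [f0 Mf]]; exists f; split => // y; rewrite superharmonicE.
have III_Tr : III -> Tr.
  move=> [f [f0 Pf]] x.
  apply: (visits_finite hp hmu (hC x) x irr hy f0) => y.
  by rewrite -superharmonicE.
have not_le1 x : ~~ (mean_nu Pr' C' x x <= 1)%E ->
    exists k, (1 < iter k (mean_op p mu) (ind x) x)%E.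
  by rewrite -ltNge nuE => /(iter_gt1_of_returns_gt1 hp hmu).
have Tr_I2 : Tr -> I2.
  move=> tr x; apply: contrapT => /negP/not_le1[k gt1].
  by have /eqP := visits_infinite hp hmu (hC x) gt1; apply; exact: tr.
have I2_I1 : I2 -> I1 by move=> h; exists y0.
have III_II : III -> II.
  move=> [f [f0 Pf]] x x0; rewrite nuE; apply: le_lt_trans (ltry (f x / f x0)).
  apply: (returns_le_superharmonic hp hmu) => // y.
  by rewrite -superharmonicE.
(* If the bound fails at [x], some iterate exceeds [1] at [x] even with a state [z] forbidden, and
   the mean number of particles frozen at [z] is infinite. *)
have II_I2 : II -> I2.
  move=> h x; apply: contrapT => /negP/not_le1[k gt1].
  have [z zx gtz] := exists_taboo hp hmu hm infX gt1.
  have := h x z; rewrite nuE (mean_returns_eq_pinfty hp hmu irr _ gtz)// ltxx.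
by split; split; tauto.
Qed.
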